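(* Let $m,n\ge0$ be integers with $m+n\ge1$, let $l,k$ be relatively prime positive integers with $l<k$, and let $q=e^{i\pi l/k}$. Let the generators $a_i^\pm,H_i$ ($i=1,\ldots,m+n$) of $U_q[osp(2n+1|2m)]$ act on the finite-dimensional Fock space $F_{l/k}(n|m)$ of $Cl_q(n|m)$ by $a_i^\pm\mapsto c_i^\pm$, $H_i\mapsto(-1)^{\langle i\rangle}N_i-\frac12$. Then $F_{l/k}(n|m)$ becomes an irreducible $U_q[osp(2n+1|2m)]$-module. If $l=1$, this representation is unitary: there is a positive definite Hermitian scalar product on $F_{1/k}(n|m)$ with respect to which $(c_i^+)^\dagger=c_i^-$ and $N_i^\dagger=N_i$ for all $i$.
   Context: Notation: $N=m+n$; $\langle i\rangle=1$ for $i\le m$ and $\langle i\rangle=0$ for $i>m$; $[x]=\frac{q^x-q^{-x}}{q-q^{-1}}$; $q=e^h$ with $h=i\pi l/k$, $q^{\pm1/2}=e^{\pm h/2}$, $q^{A}=e^{hA}$ for a diagonalizable operator $A$; $c_q=\frac{2}{q^{1/2}+q^{-1/2}}$; $[a,b]_x=ab-x\,ba$; $[\![a,b]\!]=ab-(-1)^{\deg(a)\deg(b)}ba$; $[\![a,b]\!]_x=ab-(-1)^{\deg(a)\deg(b)}x\,ba$. A $U_q[osp(2n+1|2m)]$-module is a complex vector space with operators $H_i$ (diagonalizable), $a_i^\pm$, $i=1,\ldots,N$, with $\deg(a_i^\pm)=\langle i\rangle$, $\deg(H_i)=0$, satisfying - $[H_i,H_j]=0$, $[H_i,a_j^\pm]=\pm\delta_{ij}(-1)^{\langle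 i\rangle}a_j^\pm$; - $[\![a_i^-,a_i^+]\!]=-2\,\frac{L_i-L_i^{-1}}{q-q^{-1}}$, $L_i=q^{H_i}$; - $[\,[\![a_{N-1}^\xi,a_N^\xi]\!],a_N^\xi]_{q^{-(-1)^{\langle N\rangle}}}=0$; - $[\![\,[\![a_i^\eta,a_{i+\xi}^{-\eta}]\!],a_j^\eta]\!]_{q^{-\xi(-1)^{\langle i\rangle}\delta_{ij}}}=2\,\eta^{\langle j\rangle}\delta_{j,i+\xi}L_j^{-\xi\eta}a_i^\eta$ for $\xi,\eta=\pm$ (identified with $\pm1$) and all indices in $\{1,\ldots,N\}$ (relations involving an index out of range are absent). The deformed Clifford superalgebra $Cl_q(n|m)$ has generators $c_i^\pm,N_i$ ($i=1,\ldots,N$), $\deg(c_i^\pm)=\langle i\rangle$, $\deg(N_i)=0$, and relations - $[N_i,N_j]=0$, $[N_i,c_j^\pm]=\pm\delta_{ij}c_j^\pm$; - $c_i^+c_i^-=c_q[N_i]$, $c_i^-c_i^+=c_q[1-(-1)^{\langle i\rangle}N_i]$ (equivalently $c_i^-c_i^+ +(-1)^{\langle i\rangle}q^{\pm1}c_i^+c_i^-=c_q\,q^{\pm(-1)^{\langle i\rangle}N_i}$ for both signs); - $c_i^\xi c_j^\eta=-(-1)^{\langle j\rangle}q^{\xi\eta}c_j^\eta c_i^\xi$ for $i<j$, $\xi,\eta=\pm$; - $(c_i^\pm)^2=0$ for $i>m$. The Fock space $F(n|m)$ is the $Cl_q(n|m)$-module generated by $|0\rangle$ with $c_i^-|0\rangle=0$,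 $N_i|0\rangle=0$, in which the vectors $|r_1,\ldots,r_{N}\rangle=(c_1^+)^{r_1}\cdots(c_{N}^+)^{r_{N}}|0\rangle$ ($r_i\in\mathbb{Z}_{\ge 0}$ for $i\le m$, $r_i\in\{0,1\}$ for $i>m$) form a basis. $F_{l/k}(n|m)=F(n|m)/I_{l/k}(n|m)$, where $I_{l/k}(n|m)$ is the invariant subspace spanned by the $|r_1,\ldots,r_N\rangle$ with $r_j\ge k$ for at least one $j\le m$. *)

(* Defs.v *)
From HB Require Import structures.
From mathcomp Require Import all_boot all_order all_algebra.
From mathcomp Require Import ring_quotient sesquilinear complex.
From mathcomp Require Import all_classical all_reals all_analysis.
From mathcomp Require Import ring.

Set Implicit Arguments.
Unset Strict Implicit.
Unset Printing Implicit Defensive.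

Import Order.TTheory GRing.Theory Num.Theory.

Local Open Scope classical_set_scope.
Local Open Scope ring_scope.
Local Open Scope complex_scope.
Local Open Scope quotient_scope.

Section Span.
Context (K : pzRingType) (V : lmodType K).

Definition lspan (S : set V) : {pred V} := fun v =>
  `[< exists2 s : seq (K * V),
        forall p, p \in s -> S p.2 & v = \sum_(p <- s) p.1 *: p.2 >].

Lemma lspan_submod_closed (S : set V) : submod_closed (lspan S).
Proof.
split=> [|a u v /asboolP[s Ss ->] /asboolP[t St ->]]; apply/asboolP.
  by exists [::]; rewrite ?big_nil.
exists ([seq (a * p.1, p.2) | p <- s] ++ t) => [p|].
  by rewrite mem_cat => /orP[/mapP[p' /Ss Sp' ->]|/St].
rewrite big_cat big_map scaler_sumr; congr (_ + _).
by apply: eq_bigr => p _; rewrite scalerA.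
Qed.

HB.instance Definition _ (S : set V) :=
  GRing.isSubmodClosed.Build K V (lspan S) (lspan_submod_closed S).

(* The family (e i), for i satisfying P, is a basis of V. *)
Definition is_basis (I : eqType) (P : pred I) (e : I -> V) : Prop :=
  (forall (s : seq I) (f : I -> K), uniq s -> all P s ->
     \sum_(i <- s) f i *: e i = 0 -> forall i, i \in s -> f i = 0) /\
  (forall v, v \in lspan [set e i | i in [set i | P i]]).

End Span.

Section Quotient.
Context (K : pzRingType) (V : lmodType K) (S : set V).
Local Notation I := (lspan S : zmodClosed V).

(* V / lspan S *)
Definition lquot : Type := Quotient.quot I.
HB.instance Definition _ := GRing.Zmodule.on lquot.

Definition lquot_pi (v : V) : lquot := \pi_(Quotient.quot I) v.
Definition lquot_repr (x : lquot) : V := repr (x : Quotient.quot I).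

Lemma lquot_reprK x : lquot_pi (lquot_repr x) = x.
Proof. exact: reprK. Qed.

Lemma lquot_piD u v : lquot_pi (u + v) = lquot_pi u + lquot_pi v.
Proof. by rewrite /lquot_pi !piE. Qed.

Lemma lquot_eq u v : (lquot_pi u = lquot_pi v) <-> (u - v \in I).
Proof.
have -> : (u - v \in lspan S) = (u == v %[mod Quotient.quot I]).
  exact: Quotient.idealrBE.
by split=> /eqP.
Qed.

Definition lquot_scale (a : K) (x : lquot) : lquot :=
  lquot_pi (a *: lquot_repr x).

Lemma lquot_piZ a v : lquot_scale a (lquot_pi v) = lquot_pi (a *: v).
Proof.
apply/lquot_eq; rewrite -scalerBr rpredZ //.
by apply/lquot_eq; rewrite lquot_reprK.
Qed.

Lemma lquot_scaleA a b x :
  lquot_scale a (lquot_scale b x) = lquot_scale (a * b) x.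
Proof. by rewrite -[x]lquot_reprK !lquot_piZ scalerA. Qed.

Lemma lquot_scale1 : left_id 1 lquot_scale.
Proof. by move=> x; rewrite -[x]lquot_reprK lquot_piZ scale1r. Qed.

Lemma lquot_scaleDr : right_distributive lquot_scale +%R.
Proof.
move=> a x y; rewrite -[x]lquot_reprK -[y]lquot_reprK.
by rewrite -lquot_piD !lquot_piZ -lquot_piD scalerDr.
Qed.

Lemma lquot_scaleDl x : {morph lquot_scale^~ x : a b / a + b}.
Proof.
by move=> a b; rewrite -[x]lquot_reprK !lquot_piZ -lquot_piD scalerDl.
Qed.

HB.instance Definition _ := GRing.Zmodule_isLmodule.Build K lquot
  lquot_scaleA lquot_scale1 lquot_scaleDr lquot_scaleDl.

(* The operator induced by an operator f on V leaving lspan S invariant; for *)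
(* the Fock space this invariance is fock_ideal_c and fock_ideal_N.          *)
Definition lquot_op (f : V -> V) (x : lquot) : lquot :=
  lquot_pi (f (lquot_repr x)).

Lemma lquot_opE (f : V -> V) : linear f -> (forall v, v \in I -> f v \in I) ->
  forall v, lquot_op f (lquot_pi v) = lquot_pi (f v).
Proof.
move=> lf If v; apply/lquot_eq.
have -> x y : f x - f y = f (x - y) by rewrite addrC -scaleN1r -lf scaleN1r addrC.
by apply/If/lquot_eq; rewrite lquot_reprK.
Qed.

End Quotient.

Section Operators.
Context (R : realType).
Local Notation C := R[i].

Definition cexp (z : C) : C :=
  (expR (complex.Re z))%:C * (cos (complex.Im z) +i* sin (complex.Im z)).

Section OnSpace.
Context (V : lmodType C).
Implicit Types A B : V -> V.

(* s is a list of pairs (eigenvalue, eigenvector) whose vectors sum to v. *)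
Definition eigen_decomp A (v : V) (s : seq (C * V)) : Prop :=
  (forall p, p \in s -> A p.2 = p.1 *: p.2) /\ v = \sum_(p <- s) p.2.

Definition is_diagonalizable A : Prop := forall v, exists s, eigen_decomp A v s.

(* e^{hA} for A diagonalizable; expopE shows that the choice of the          *)
(* decomposition is irrelevant.                                              *)
Definition expop (h : C) A (v : V) : V :=
  \sum_(p <- xget [::] [set s | eigen_decomp A v s]) cexp (h * p.1) *: p.2.

(* [A] = (q^A - q^{-A}) / (q - q^{-1}) with q = e^h *)
Definition qbracket (h : C) A (v : V) : V :=
  (cexp h - (cexp h)^-1)^-1 *: (expop h A v - expop (- h) A v).

(* [A, B]_x *)
Definition commx (x : C) A B (v : V) : V := A (B v) - x *: B (A v).

(* [[A, B]]_x for A, B homogeneous of degrees d, e *)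
Definition scommx (d e : nat) (x : C) A B : V -> V :=
  commx ((-1) ^+ (d * e) * x) A B.

End OnSpace.

(* Signs are booleans: true is +, false is -. *)
Definition sg (xi : bool) : int := if xi then 1 else -1.

(* The indices 1, ..., m + n are shifted to 0, ..., m + n - 1, so that <i>   *)
(* is 1 exactly when i < m.                                                  *)
Definition par (m N : nat) (i : 'I_N) : nat := (i < m)%N.

(* j = i + xi *)
Definition shifted (N : nat) (xi : bool) (i j : 'I_N) : Prop :=
  if xi then j = i.+1 :> nat else i = j.+1 :> nat.

Section Modules.
Context (h : C) (m n : nat) (V : lmodType C).
Local Notation N := (m + n)%N.
Local Notation q := (cexp h).
Local Notation par := (@par m N).

Record is_Uq_osp_module (a : bool -> 'I_N -> V -> V) (H : 'I_N -> V -> V) :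
  Prop := {
  Uq_a_linear : forall xi i, linear (a xi i);
  Uq_H_linear : forall i, linear (H i);
  Uq_H_diag : forall i, is_diagonalizable (H i);
  Uq_HH : forall i j, commx 1 (H i) (H j) =1 fun=> 0;
  Uq_Ha : forall xi i j v, commx 1 (H i) (a xi j) v =
    ((sg xi)%:~R * (i == j)%:R * (-1) ^+ par i) *: a xi j v;
  Uq_aa : forall i v, scommx (par i) (par i) 1 (a false i) (a true i) v =
    - (2 / (q - q^-1)) *: (expop h (H i) v - expop (- h) (H i) v);
  Uq_serre : forall xi (i j : 'I_N), i.+1 = j -> j.+1 = N ->
    commx (q ^ (- (-1) ^+ par j))
      (scommx (par i) (par j) 1 (a xi i) (a xi j)) (a xi j) =1 fun=> 0;
  Uq_triple : forall xi eta (i i' j : 'I_N) v, shifted xi i i' ->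
    scommx (par i + par i') (par j)
      (q ^ (- sg xi * (-1) ^+ par i * (i == j)%:R))
      (scommx (par i) (par i') 1 (a eta i) (a (~~ eta) i')) (a eta j) v =
    (2 * (sg eta)%:~R ^+ par j * (j == i')%:R) *:
      expop (- (sg xi * sg eta)%:~R * h) (H j) (a eta i v)
}.

Definition is_irreducible (a : bool -> 'I_N -> V -> V) (H : 'I_N -> V -> V) :
  Prop :=
  (exists v : V, v != 0) /\
  forall W : {pred V}, submod_closed W ->
    (forall xi i v, v \in W -> a xi i v \in W) ->
    (forall i v, v \in W -> H i v \in W) ->
    (forall v, v \in W -> v = 0) \/ (forall v, v \in W).

Definition c_q : C := 2 / (cexp (h / 2) + cexp (- h / 2)).

Record is_Clq_module (c : bool -> 'I_N -> V -> V) (Nop : 'I_N -> V -> V) :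
  Prop := {
  Clq_c_linear : forall xi i, linear (c xi i);
  Clq_N_linear : forall i, linear (Nop i);
  Clq_N_diag : forall i, is_diagonalizable (Nop i);
  Clq_NN : forall i j, commx 1 (Nop i) (Nop j) =1 fun=> 0;
  Clq_Nc : forall xi i j v, commx 1 (Nop i) (c xi j) v =
    ((sg xi)%:~R * (i == j)%:R) *: c xi j v;
  Clq_cpcm : forall i v, c true i (c false i v) = c_q *: qbracket h (Nop i) v;
  Clq_cmcp : forall i v, c false i (c true i v) =
    c_q *: qbracket h (fun u => u - (-1) ^+ par i *: Nop i u) v;
  Clq_exchange : forall xi eta (i j : 'I_N) v, (i < j)%N ->
    c xi i (c eta j v) =
    (- (-1) ^+ par j * q ^ (sg xi * sg eta)) *: c eta j (c xi i v);
  Clq_nilpotent : forall xi (i : 'I_N) v, (m <= i)%N -> c xi i (c xi i v) = 0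
}.

(* occupation numbers r_1, ..., r_N *)
Definition occupation (r : {ffun 'I_N -> nat}) : bool :=
  [forall i : 'I_N, (m <= i)%N ==> (r i <= 1)%N].

(* |r_1, ..., r_N> = (c_1^+)^{r_1} ... (c_N^+)^{r_N} |0> *)
Definition ket (c : bool -> 'I_N -> V -> V) (vac : V)
    (r : {ffun 'I_N -> nat}) : V :=
  foldr (fun i => iter (r i) (c true i)) vac (enum 'I_N).

(* V is the Fock space F(n|m) with vacuum vac; that vac generates V is part  *)
(* of the basis condition.                                                   *)
Record is_Fock (c : bool -> 'I_N -> V -> V) (Nop : 'I_N -> V -> V) (vac : V) :
  Prop := {
  Fock_Clq : is_Clq_module c Nop;
  Fock_c_vac : forall i, c false i vac = 0;
  Fock_N_vac : forall i, Nop i vac = 0;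
  Fock_basis : is_basis occupation (ket c vac)
}.

(* I_{l/k}(n|m) is the span of these; only the denominator k matters. *)
Definition fock_cutoff (k : nat) (c : bool -> 'I_N -> V -> V) (vac : V) :
  set V :=
  [set ket c vac r | r in
    [set r | occupation r /\ exists2 j : 'I_N, (j < m)%N & (k <= r j)%N]].

(* F_{l/k}(n|m) *)
Definition fock_quot (k : nat) (c : bool -> 'I_N -> V -> V) (vac : V) :
  lmodType C := lquot (fock_cutoff k c vac).

End Modules.

Definition qexponent (l k : nat) : C := 'i * (pi * l%:R / k%:R)%:C.

End Operators.

Section Facts.
Context (R : realType).
Local Notation C := R[i].

Lemma cexp0 : cexp (0 : C) = 1.
Proof. by rewrite /cexp /= expR0 cos0 sin0 mul1r. Qed.

Lemma cexpD (x y : C) : cexp (x + y) = cexp x * cexp y.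
Proof.
case: x y => [a b] [c d]; rewrite /cexp /= expRD cosD sinD.
by apply/eqP; rewrite eq_complex /=; apply/andP; split; apply/eqP; ring.
Qed.

Lemma cexp_neq0 (x : C) : cexp x != 0.
Proof.
apply/eqP => x0; have := oner_neq0 C.
have : cexp (x - x) = 0 by rewrite cexpD x0 mul0r.
by rewrite subrr cexp0 => ->; rewrite eqxx.
Qed.

Lemma cexpN (x : C) : cexp (- x) = (cexp x)^-1.
Proof.
by apply: (mulIf (cexp_neq0 x)); rewrite mulVf ?cexp_neq0 // -cexpD addNr cexp0.
Qed.

Lemma interpolation (xs : seq C) (f : C -> C) :
  exists p : {poly C}, {in xs, forall x, p.[x] = f x}.
Proof.
elim: xs => [|x xs [p pf]]; first by exists 0.
have [x_xs|x_xs] := boolP (x \in xs).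
  by exists p => y; rewrite inE => /predU1P[->|]; apply: pf.
pose w := \prod_(z <- xs) ('X - z%:P) : {poly C}.
have w0 : w.[x] != 0 by rewrite -[_ == _]/(root w x) root_prod_XsubC.
exists (p + ((f x - p.[x]) / w.[x]) *: w) => y; rewrite inE => /predU1P[->|yxs].
  by rewrite !hornerE -mulrA mulVf // mulr1 addrC subrK.
have /eqP : root w y by rewrite root_prod_XsubC.
by rewrite !hornerE => ->; rewrite mulr0 addr0 pf.
Qed.

Lemma linZ (V : lmodType C) (A : V -> V) : linear A -> scalable A.
Proof.
move=> lA a v; pose L : {linear V -> V} :=
  HB.pack A (GRing.isLinear.Build _ _ _ _ A lA).
by rewrite -[A]/(L : _ -> _) linearZ.
Qed.

Section OnSpace.
Context (V : lmodType C) (A : V -> V).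
Hypothesis lA : linear A.

Lemma eigen_sum0 (s : seq (C * V)) (f : C -> C) :
  (forall p, p \in s -> A p.2 = p.1 *: p.2) -> \sum_(p <- s) p.2 = 0 ->
  \sum_(p <- s) f p.1 *: p.2 = 0.
Proof.
move=> eA s0; have [P Pf] := interpolation (map fst s) f.
pose L : {linear V -> V} := HB.pack A (GRing.isLinear.Build _ _ _ _ A lA).
have iterA i p : p \in s -> iter i L p.2 = p.1 ^+ i *: p.2.
  move=> ps; elim: i => [|i IH]; first by rewrite scale1r.
  by rewrite iterS IH linearZ /= eA // scalerA exprSr.
have iter_sum i : \sum_(p <- s) iter i L p.2 = 0.
  elim: i => [|i IH] //.
  transitivity (L (\sum_(p <- s) iter i L p.2)); last by rewrite IH linear0.
  by rewrite linear_sum.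
transitivity (\sum_(i < size P) P`_i *: \sum_(p <- s) iter i L p.2); last first.
  by rewrite big1 // => i _; rewrite iter_sum scaler0.
under [RHS]eq_bigr do rewrite scaler_sumr.
rewrite exchange_big /= !big_seq; apply: eq_bigr => p ps.
rewrite -Pf ?map_f // horner_coef scaler_suml; apply: eq_bigr => i _.
by rewrite iterA // scalerA.
Qed.

Lemma expopE (h : C) (v : V) (s : seq (C * V)) : eigen_decomp A v s ->
  expop h A v = \sum_(p <- s) cexp (h * p.1) *: p.2.
Proof.
move=> [sA vs]; rewrite /expop; case: xgetP => [t _ [tA vt]|/(_ s)]; last by case.
apply/eqP; rewrite -subr_eq0; apply/eqP.
pose s' : seq (C * V) := [seq (p.1, - p.2) | p <- s].
rewrite -sumrN.
transitivity (\sum_(p <- t ++ s') cexp (h * p.1) *: p.2).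
  rewrite big_cat big_map; congr (_ + _).
  by apply: eq_bigr => p _; rewrite scalerN.
apply: (eigen_sum0 (fun x => cexp (h * x))) => [p|].
  rewrite mem_cat => /orP[/tA//|/mapP[p' /sA sAp' ->]] /=.
  pose L : {linear V -> V} := HB.pack A (GRing.isLinear.Build _ _ _ _ A lA).
  by rewrite -[A]/(L : _ -> _) linearN /= sAp' scalerN.
by rewrite big_cat big_map /= sumrN -vt -vs subrr.
Qed.

Lemma expop_eigen (h a : C) (v : V) : A v = a *: v ->
  expop h A v = cexp (h * a) *: v.
Proof.
move=> Av; rewrite (@expopE h v [:: (a, v)]) ?big_seq1 //.
by split; rewrite ?big_seq1 // => p; rewrite inE => /eqP ->.
Qed.

Lemma lspan_stable (S : set V) : (forall v, S v -> A v \in lspan S) ->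
  forall v, v \in lspan S -> A v \in lspan S.
Proof.
move=> AS v /asboolP[s Ss ->].
pose L : {linear V -> V} := HB.pack A (GRing.isLinear.Build _ _ _ _ A lA).
rewrite -[A]/(L : _ -> _) linear_sum big_seq rpred_sum // => p /Ss Sp.
by rewrite linearZ rpredZ //; exact: AS.
Qed.

End OnSpace.

Lemma mem_lspan (V : lmodType C) (S : set V) v : S v -> v \in lspan S.
Proof.
move=> Sv; apply/asboolP; exists [:: (1, v)]; last by rewrite big_seq1 scale1r.
by move=> p; rewrite inE => /eqP ->.
Qed.

Section FockFacts.
Context (h : C) (m n : nat) (V : lmodType C).
Local Notation N := (m + n)%N.
Context (c : bool -> 'I_N -> V -> V) (Nop : 'I_N -> V -> V) (vac : V).
Hypothesis FV : is_Fock h c Nop vac.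
Local Notation occ := {ffun 'I_N -> nat}.

Let lc xi i : linear (c xi i) := Clq_c_linear (Fock_Clq FV) xi i.
Let lN i : linear (Nop i) := Clq_N_linear (Fock_Clq FV) i.

Let ketl (r : occ) (s : seq 'I_N) : V :=
  foldr (fun i => iter (r i) (c true i)) vac s.

Let Nc i j v a : Nop i v = a *: v ->
  Nop i (c true j v) = (a + (i == j)%:R) *: c true j v.
Proof.
move=> Nv; have := Clq_Nc (Fock_Clq FV) true i j v.
rewrite /commx Nv (linZ (lc _ _)) scale1r mul1r => /eqP.
by rewrite subr_eq -scalerDl addrC => /eqP.
Qed.

Let N_iter i j v a t : Nop i v = a *: v ->
  Nop i (iter t (c true j) v) = (a + (t * (i == j))%:R) *: iter t (c true j) v.
Proof.
move=> Nv; elim: t => [|t IH]; first by rewrite mul0n addr0.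
by rewrite iterS (Nc _ IH) -addrA -natrD mulSn addnC.
Qed.

Lemma N_ketl i r s :
  Nop i (ketl r s) = (\sum_(j <- s) r j * (i == j))%:R *: ketl r s.
Proof.
elim: s => [|j s IH]; first by rewrite big_nil scale0r (Fock_N_vac FV).
by rewrite big_cons natrD addrC; apply: N_iter.
Qed.

Lemma N_ket i (r : occ) : Nop i (ket c vac r) = (r i)%:R *: ket c vac r.
Proof.
rewrite [LHS]N_ketl; congr (_%:R *: _).
rewrite big_enum /= (bigD1 i) //= eqxx muln1 big1 ?addn0 // => j.
by rewrite eq_sym => /negPf ->; rewrite muln0.
Qed.


(* c_i^xi passes, up to a scalar, through creation operators of index <> i. *)
Let pass xi (i j : 'I_N) t : j != i -> exists a : C, forall v,
  c xi i (iter t (c true j) v) = a *: iter t (c true j) (c xi i v).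
Proof.
move=> ij.
have [b bP] : exists b : C, forall w,
    c xi i (c true j w) = b *: c true j (c xi i w).
  case: (ltngtP i j) => [lt|gt|/val_inj eq]; last by rewrite eq eqxx in ij.
    by eexists => w; apply: (Clq_exchange (Fock_Clq FV)).
  exists (- (-1) ^+ par m i * cexp h ^ (sg true * sg xi))^-1 => w.
  rewrite (Clq_exchange (Fock_Clq FV) true xi w gt) scalerA mulVf ?scale1r //.
  by rewrite mulf_neq0 ?expfz_neq0 ?cexp_neq0 // oppr_eq0 signr_eq0.
elim: t => [|t [a IH]]; first by exists 1 => v; rewrite scale1r.
by exists (b * a) => v; rewrite !iterS bP IH (linZ (lc _ _)) scalerA.
Qed.

Let iterZ j t a v : iter t (c true j) (a *: v) = a *: iter t (c true j) v.
Proof. by elim: t => // t IH; rewrite !iterS IH (linZ (lc _ _)). Qed.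

Let passl xi i (r : occ) s : i \notin s -> exists a : C, forall v,
  c xi i (foldr (fun j => iter (r j) (c true j)) v s) =
  a *: foldr (fun j => iter (r j) (c true j)) (c xi i v) s.
Proof.
elim: s => [_|j s IH]; first by exists 1 => v; rewrite scale1r.
rewrite inE negb_or eq_sym => /andP[ij /IH[a aP]].
have [b bP] := pass xi (r j) ij.
by exists (b * a) => v; rewrite /= bP aP iterZ scalerA.
Qed.

Let foldrZ (r : occ) s a v : foldr (fun j => iter (r j) (c true j)) (a *: v) s =
  a *: foldr (fun j => iter (r j) (c true j)) v s.
Proof. by elim: s => //= j s ->; rewrite iterZ. Qed.

Let foldr0 (r : occ) s : foldr (fun j => iter (r j) (c true j)) 0 s = 0.
Proof. by rewrite -[X in foldr _ X](scale0r vac) foldrZ scale0r. Qed.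

Definition upd (r : occ) (i : 'I_N) (x : nat) : occ :=
  [ffun j => if j == i then x else r j].

Let enum_split i : exists s1 s2,
  [/\ enum 'I_N = s1 ++ i :: s2, i \notin s1 & i \notin s2].
Proof.
have := enum_uniq 'I_N; have /splitPr[s1 s2] := mem_enum 'I_N i.
rewrite cat_uniq /= negb_or => /and3P[_ /andP[i1 _] /andP[i2 _]].
by exists s1, s2.
Qed.

Let foldr_upd r i x s v : i \notin s ->
  foldr (fun j => iter (upd r i x j) (c true j)) v s =
  foldr (fun j => iter (r j) (c true j)) v s.
Proof.
elim: s => //= j s IH; rewrite inE negb_or eq_sym => /andP[ij /IH ->].
by rewrite ffunE (negPf ij).
Qed.

Lemma cplus_ket i (r : occ) : exists a : C,
  c true i (ket c vac r) = a *: ket c vac (upd r i (r i).+1).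
Proof.
have [s1 [s2 [E i1 i2]]] := enum_split i.
have [a aP] := passl true r i1; exists a.
by rewrite /ket E !foldr_cat /= aP !foldr_upd // ffunE eqxx.
Qed.

Definition cminus_coef (i : 'I_N) (t : nat) : C :=
  let x := 1 - (-1) ^+ par m i * t%:R in
  c_q h * ((cexp h - (cexp h)^-1)^-1 * (cexp (h * x) - cexp (- h * x))).

Lemma cminus_ket0 i (r : occ) : r i = 0%N -> c false i (ket c vac r) = 0.
Proof.
move=> ri; have [s1 [s2 [E i1 i2]]] := enum_split i.
have [a aP] := passl false r i1; have [b bP] := passl false r i2.
rewrite /ket E !foldr_cat /= aP ri /= bP (Fock_c_vac FV).
by rewrite !foldr0 scaler0 foldr0 scaler0.
Qed.

Lemma cminus_ket i (r : occ) t : r i = t.+1 -> exists a : C,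
  c false i (ket c vac r) = (a * cminus_coef i t) *: ket c vac (upd r i t).
Proof.
move=> ri; have [s1 [s2 [E i1 i2]]] := enum_split i.
have [a aP] := passl false r i1; exists a.
rewrite /ket E !foldr_cat /= aP ri /= !foldr_upd // ffunE eqxx -scalerA.
rewrite -[in RHS]foldrZ; congr (_ *: foldr _ _ _).
set v := foldr _ vac s2; set w := iter t _ v.
have Nw : Nop i w = t%:R *: w.
  rewrite /w /v (N_iter _ _ (N_ketl i r s2)) eqxx muln1 big_seq big1 ?add0r //.
  move=> j js; case: eqP => [ij|_]; last by rewrite muln0.
  by rewrite ij js in i2.
set A := fun u => u - (-1) ^+ par m i *: Nop i u.
have lA : linear A.
  move=> x u u'; rewrite /A lN !scalerDr !scalerN opprD !scalerA.
  by rewrite [x * _]mulrC addrACA.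
have Aw : A w = (1 - (-1) ^+ par m i * t%:R) *: w.
  by rewrite /A Nw scalerA scalerBl scale1r.
rewrite (Clq_cmcp (Fock_Clq FV)) /qbracket !(expop_eigen lA _ Aw).
by rewrite -scalerBl !scalerA /cminus_coef mulrA.
Qed.

Lemma ket_eq0 (i : 'I_N) (r : occ) : (m <= i)%N -> (1 < r i)%N -> ket c vac r = 0.
Proof.
move=> mi ri; have [s1 [s2 [E i1 i2]]] := enum_split i.
rewrite /ket E foldr_cat /=; case E': (r i) ri => [|[|t]] // _ /=.
by rewrite (Clq_nilpotent (Fock_Clq FV)) // foldr0.
Qed.

Lemma ket_occ (r : occ) : ~~ occupation r -> ket c vac r = 0.
Proof.
case/forallPn => i; rewrite negb_imply -ltnNge => /andP[]; exact: ket_eq0.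
Qed.

End FockFacts.

(* I_{l/k}(n|m) is invariant under Cl_q(n|m). *)
Section Invariance.
Context (l k m n : nat) (V : lmodType C).
Hypothesis k_gt0 : (0 < k)%N.
Local Notation N := (m + n)%N.
Local Notation h := (qexponent R l k).
Context (c : bool -> 'I_N -> V -> V) (Nop : 'I_N -> V -> V) (vac : V).
Hypothesis FV : is_Fock h c Nop vac.
Local Notation I := (lspan (fock_cutoff k c vac)).

Let sin_natpi t : sin (pi * t%:R : R) = 0.
Proof.
elim: t => [|t IH]; first by rewrite mulr0 sin0.
by rewrite -natr1 mulrDr mulr1 sinD IH sinpi mul0r mulr0 addr0.
Qed.

Let cexp_hk : cexp (h * k%:R) = cexp (- h * k%:R).
Proof.
rewrite mulNr; have -> : h * k%:R = (0 : R) +i* (pi * l%:R).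
  have k0 : (k%:R : R) != 0 by rewrite pnatr_eq0 -lt0n.
  have -> : (k%:R : C) = (k%:R : R)%:C by rewrite rmorph_nat.
  apply/eqP; rewrite eq_complex /=.
  by rewrite !(mul0r, mul1r, mulr0, subrr, addr0, add0r, subr0) mulfVK ?oppr0 ?mul0r ?eqxx.
by apply/eqP; rewrite /cexp eq_complex /= oppr0 cosN sinN sin_natpi !oppr0 !eqxx.
Qed.

Let cmk (i : 'I_N) : (i < m)%N -> cminus_coef h i k.-1 = 0.
Proof.
move=> im; rewrite /cminus_coef /par im expr1 mulN1r opprK.
by rewrite nat1r prednK // cexp_hk subrr !mulr0.
Qed.

Let cutoff_ket (r : {ffun 'I_N -> nat}) (j : 'I_N) :
  (j < m)%N -> (k <= r j)%N -> ket c vac r \in I.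
Proof.
move=> jm kr; have [ro|/(ket_occ FV) ->] := boolP (occupation r); last first.
  exact: rpred0.
by apply: mem_lspan; exists r => //; split=> //; exists j.
Qed.

Lemma fock_ideal_c xi i v : v \in I -> c xi i v \in I.
Proof.
apply: lspan_stable; first exact: Clq_c_linear (Fock_Clq FV) xi i.
move=> _ [r [ro [j jm kr]] <-]; case: xi.
  have [a ->] := cplus_ket FV i r; rewrite rpredZ //.
  by apply: (cutoff_ket jm); rewrite ffunE; case: eqP => [<-|//]; apply: leqW.
case ri: (r i) => [|t]; first by rewrite (cminus_ket0 FV) // rpred0.
have [a ->] := cminus_ket FV ri; have [ij|ij] := eqVneq j i.
  rewrite {j}ij in jm kr; move: kr; rewrite ri leq_eqVlt => /predU1P[kt|kt].
    by rewrite -[t]/(t.+1.-1) -kt cmk // mulr0 scale0r rpred0.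
  by rewrite rpredZ // (cutoff_ket jm) // ffunE eqxx.
by rewrite rpredZ // (cutoff_ket jm) // ffunE (negPf ij).
Qed.

Lemma fock_ideal_N i v : v \in I -> Nop i v \in I.
Proof.
apply: lspan_stable; first exact: Clq_N_linear (Fock_Clq FV) i.
move=> _ [r [ro [j jm kr]] <-]; rewrite (N_ket FV) rpredZ //.
exact: (cutoff_ket jm).
Qed.

(* F_{l/k}(n|m) is finite-dimensional. *)
Lemma fock_quot_finite : exists s : seq (fock_quot k c vac),
  forall x, x \in lspan [set` s].
Proof.
pose G := {ffun 'I_N -> 'I_k.+2}.
pose e (g : G) : fock_quot k c vac := lquot_pi _ (ket c vac [ffun i => g i : nat]).
exists (map e (enum {: G})) => x; rewrite -[x]lquot_reprK.
have /asboolP[s sP ->] := proj2 (Fock_basis FV) (lquot_repr x).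
have piZ a v : lquot_pi (fock_cutoff k c vac) (a *: v) = a *: lquot_pi _ v.
  by rewrite -lquot_piZ.
elim: s sP => [_|[a v] s IH sP].
  rewrite big_nil -(scale0r 0) piZ scale0r; exact: rpred0.
rewrite big_cons lquot_piD; apply: rpredD; last first.
  by apply: IH => p ps; apply: sP; rewrite inE ps orbT.
rewrite piZ rpredZ //=; have [r ro /= <-] := sP (a, v) (mem_head _ _).
have [/existsP[j /andP[jm kr]]|/existsPn H] :=
  boolP [exists j : 'I_N, (j < m)%N && (k <= r j)%N].
  have -> : lquot_pi (fock_cutoff k c vac) (ket c vac r) = lquot_pi _ 0.
    by apply/lquot_eq; rewrite subr0 (cutoff_ket jm).
  rewrite -(scale0r 0) piZ scale0r; exact: rpred0.
have rk i : (r i < k.+2)%N.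
  have := H i; rewrite negb_and -leqNgt -ltnNge => /orP[mi|/ltnW/leqW //].
  by have /forallP/(_ i)/implyP/(_ mi) := ro; rewrite !ltnS => /leq_trans; apply.
apply: mem_lspan; apply/mapP; exists [ffun i => Ordinal (rk i)].
  by rewrite mem_enum.
by congr (lquot_pi _ (ket c vac _)); apply/ffunP => i; rewrite !ffunE.
Qed.

End Invariance.
End Facts.

(* Existence of F(n|m), realised on the finitely supported functions on the  *)
(* set of occupation numbers.                                                *)
Module FockModel.
Section Model.
Context (R : realType) (m n : nat).
Local Notation C := R[i].
Local Notation N := (m + n)%N.
Local Notation occ := {ffun 'I_N -> nat}.

Definition finsupp_pred : {pred (occ -> C)} := fun f =>
  `[< (forall r, ~~ occupation r -> f r = 0) /\
      exists s : seq occ, forall r, r \notin s -> f r = 0 >].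

Lemma finsupp_submod_closed : submod_closed finsupp_pred.
Proof.
split=> [|a f g /asboolP[f0 [s fs]] /asboolP[g0 [t gt]]]; apply/asboolP.
  by split => //; exists [::].
split=> [r r0|]; first by rewrite !fctE f0 // g0 // scaler0 addr0.
exists (s ++ t) => r; rewrite mem_cat negb_or => /andP[/fs fr /gt gr].
by rewrite !fctE fr gr scaler0 addr0.
Qed.

HB.instance Definition _ := GRing.isSubmodClosed.Build C (occ -> C)
  finsupp_pred finsupp_submod_closed.

Record fockT := FockT { fval : occ -> C; _ : fval \in finsupp_pred }.
HB.instance Definition _ := [isSub for fval].
HB.instance Definition _ := [Choice of fockT by <:].
HB.instance Definition _ := [SubChoice_isSubLmodule of fockT by <:].

Context (h : C).
Implicit Types (f : fockT) (r : occ) (i j : 'I_N) (xi eta : bool).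

Lemma fval_occ f r : ~~ occupation r -> fval f r = 0.
Proof. by case: f => f /= /asboolP[f0 _]; apply: f0. Qed.

Lemma fval_supp f : exists s : seq occ, forall r, r \notin s -> fval f r = 0.
Proof. by case: f => f /= /asboolP[_]. Qed.

Lemma fockP f g : fval f =1 fval g -> f = g.
Proof. by move=> fg; apply/val_inj/funext. Qed.

Lemma fvalD f g r : fval (f + g) r = fval f r + fval g r. Proof. by []. Qed.
Lemma fvalB f g r : fval (f - g) r = fval f r - fval g r. Proof. by []. Qed.
Lemma fvalZ a f r : fval (a *: f) r = a * fval f r. Proof. by []. Qed.
Lemma fval0 r : fval 0 r = 0. Proof. by []. Qed.
Lemma fval_sum T (s : seq T) (F : T -> fockT) r :
  fval (\sum_(x <- s) F x) r = \sum_(x <- s) fval (F x) r.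
Proof. by elim/big_ind2: _ => // x1 x2 y1 y2 <- <-. Qed.

Lemma linP (g : fockT -> fockT) :
  (forall a u v r, fval (g (a *: u + v)) r = a * fval (g u) r + fval (g v) r) ->
  linear g.
Proof. by move=> H a u v; apply: fockP => r; rewrite H fvalD fvalZ. Qed.

Lemma dlt_subproof r0 :
  (fun r => ((r == r0) && occupation r)%:R : C) \in finsupp_pred.
Proof.
apply/asboolP; split=> [r /negPf ->|]; first by rewrite andbF.
by exists [:: r0] => r; rewrite inE => /negPf ->.
Qed.
Definition dlt r0 : fockT := FockT (dlt_subproof r0).
Lemma dltE r0 r : fval (dlt r0) r = ((r == r0) && occupation r)%:R.
Proof. by []. Qed.

Lemma dlt_decomp f : exists s : seq occ, [/\ uniq s, all (@occupation m n) s &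
  f = \sum_(r <- s) fval f r *: dlt r].
Proof.
have [s fs] := fval_supp f; pose s' := undup (seq.filter (@occupation m n) s).
have s'u : uniq s' by exact: undup_uniq.
have s'o : all (@occupation m n) s'.
  by apply/allP => r; rewrite mem_undup mem_filter => /andP[].
exists s'; split => //; apply: fockP => r; rewrite fval_sum.
under eq_bigr do rewrite fvalZ dltE.
have [rs|rs] := boolP (r \in s').
  rewrite (bigD1_seq r) //= (allP s'o) // eqxx mulr1 big1 ?addr0 // => r'.
  by rewrite eq_sym => /negPf ->; rewrite mulr0.
rewrite big_seq big1 => [|r' r's]; last first.
  case: eqP => [rr|]; last by rewrite mulr0.
  by rewrite -rr (negPf rs) in r's.
move: rs; rewrite mem_undup mem_filter negb_and => /orP[|/fs //].
exact: fval_occ.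
Qed.

Section Diag.
Context (A : fockT -> fockT) (lam : occ -> C).
Hypothesis AE : forall f r, fval (A f) r = lam r * fval f r.

Lemma diag_linear : linear A.
Proof. by apply: linP => a u v r; rewrite !AE fvalD fvalZ; ring. Qed.

Lemma diag_dlt r : A (dlt r) = lam r *: dlt r.
Proof.
apply: fockP => r'; rewrite AE fvalZ /=.
by case: eqP => [->|]; rewrite ?mulr0.
Qed.

Lemma diag_decomp f : exists s : seq occ,
  eigen_decomp A f [seq (lam r, fval f r *: dlt r) | r <- s].
Proof.
have [s [_ _ fE]] := dlt_decomp f; exists s; split; last by rewrite big_map.
move=> _ /mapP[r _ ->] /=.
by rewrite (linZ diag_linear) diag_dlt !scalerA mulrC.
Qed.

Lemma diag_diag : is_diagonalizable A.
Proof. by move=> f; have [s sP] := diag_decomp f; eexists; exact: sP. Qed.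

Lemma diag_expop (x : C) f r :
  fval (expop x A f) r = cexp (x * lam r) * fval f r.
Proof.
have [s sP] := diag_decomp f.
rewrite (expopE diag_linear x sP) big_map fval_sum /=.
rewrite {2}(proj2 sP) big_map fval_sum mulr_sumr; apply: eq_bigr => r' _.
rewrite -[LHS]/(cexp (x * lam r') * (fval f r' * fval (dlt r') r)).
rewrite -[RHS]/(cexp (x * lam r) * (fval f r' * fval (dlt r') r)) dltE.
by case: eqP => [->|_]; rewrite ?mulr0.
Qed.

Lemma diag_qbracket f r : fval (qbracket h A f) r =
  (cexp h - (cexp h)^-1)^-1 * (cexp (h * lam r) - cexp (- h * lam r)) *
  fval f r.
Proof. by rewrite /qbracket fvalZ fvalB !diag_expop; ring. Qed.

End Diag.

Lemma num_subproof i f : (fun r => (r i)%:R * fval f r) \in finsupp_pred.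
Proof.
apply/asboolP; split=> [r r0|]; first by rewrite fval_occ ?mulr0.
by have [s fs] := fval_supp f; exists s => r /fs ->; rewrite mulr0.
Qed.
Definition num i f : fockT := FockT (num_subproof i f).

Lemma numE i f r : fval (num i f) r = (r i)%:R * fval f r.
Proof. by []. Qed.

(* sh xi j r is r - xi e_j *)
Definition sh xi j r : occ :=
  upd r j (if xi then (r j).-1 else (r j).+1).

Definition qn (x : nat) : C :=
  (cexp h - (cexp h)^-1)^-1 * (cexp (h * x%:R) - cexp (- h * x%:R)).

Definition amp xi j r : C :=
  if xi then ((0 < r j) && ((j < m) || (r j <= 1)))%N%:R
  else c_q h * qn (r j).+1.

Definition wgt xi j : C := - (-1) ^+ par m j * cexp h ^ (- sg xi).
Definition cum j r : int := \sum_(a < N | (a < j)%N) (r a)%:Z.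

Lemma cre_subproof xi j f :
  (fun r => wgt xi j ^ cum j r * (amp xi j r * fval f (sh xi j r)))
   \in finsupp_pred.
Proof.
apply/asboolP; split=> [r r0|].
  case: xi; last first.
    rewrite (@fval_occ f) ?mulr0 //; apply: contra r0 => /forallP r0.
    apply/forallP => i; apply/implyP => mi; have /implyP/(_ mi) := r0 i.
    rewrite /sh ffunE; case: eqP => [->|//]; exact: ltnW.
  rewrite /amp; case: andP => [[rj jr]|]; last by rewrite mul0r mulr0.
  rewrite (@fval_occ f) ?mulr0 //; apply: contra r0 => /forallP r0.
  apply/forallP => i; apply/implyP => mi; have /implyP/(_ mi) := r0 i.
  by rewrite /sh ffunE; case: eqP => [ij|//]; move: jr; rewrite -ij ltnNge mi.
have [s fs] := fval_supp f; exists (map (sh (~~ xi) j) s) => r rs.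
have [H|H] := boolP ((xi && (r j == 0%N))).
  by case/andP: H => -> /eqP rj; rewrite /amp rj /= mul0r mulr0.
rewrite fs ?mulr0 //; apply: contra rs => rs; apply/mapP; eexists; first exact: rs.
apply/ffunP => a; rewrite /sh !ffunE eqxx; case: eqP => [->|//].
by case: xi H {rs} => //= /negPf; case: (r j).
Qed.
Definition cre xi j f : fockT := FockT (cre_subproof xi j f).

Lemma creE xi j f r : fval (cre xi j f) r =
  wgt xi j ^ cum j r * (amp xi j r * fval f (sh xi j r)).
Proof. by []. Qed.

Lemma wgt_neq0 xi j : wgt xi j != 0.
Proof. by rewrite mulf_neq0 ?expfz_neq0 ?cexp_neq0 // oppr_eq0 signr_eq0. Qed.

Lemma cum_sh_ge xi i j r : (i <= j)%N -> cum i (sh xi j r) = cum i r.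
Proof.
move=> ij; apply: eq_bigr => a ai; rewrite ffunE; case: eqP => // E.
by rewrite E ltnNge ij in ai.
Qed.

Lemma cum_sh_lt xi i j r : (i < j)%N -> ~~ (xi && (r i == 0%N)) ->
  cum j (sh xi i r) = cum j r - sg xi.
Proof.
move=> ij H; rewrite /cum (bigD1 i) //= [in RHS](bigD1 i) //= ffunE eqxx.
rewrite (eq_bigr (fun a => (r a)%:Z)); last first.
  by move=> a /andP[_ /negPf ai]; rewrite ffunE ai.
rewrite addrAC; congr (_ + _).
case: xi H => /= H; rewrite /sg; last by rewrite opprK -addn1 PoszD.
by case: (r i) H => // x _; rewrite -addn1 PoszD addrK addn1.
Qed.

Lemma sh_comm xi eta i j r : i != j -> sh xi i (sh eta j r) = sh eta j (sh xi i r).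
Proof.
move=> ij; have ji : (j == i) = false by rewrite eq_sym (negPf ij).
apply/ffunP => a; rewrite /sh !ffunE ?(negPf ij) ?ji.
by have [->|//] := eqVneq a i; rewrite (negPf ij).
Qed.

Lemma shK xi j r : ~~ (xi && (r j == 0%N)) -> sh (~~ xi) j (sh xi j r) = r.
Proof.
move=> H; apply/ffunP => a; rewrite /sh !ffunE eqxx.
case: eqP => [->|//]; case: xi H => //=; by case: (r j).
Qed.

Lemma amp_sh xi eta i j r : i != j -> amp xi i (sh eta j r) = amp xi i r.
Proof. by move=> ij; rewrite /amp /sh !ffunE (negPf ij). Qed.

Lemma sh_eq xi j r : sh xi j r j = if xi then (r j).-1 else (r j).+1.
Proof. by rewrite ffunE eqxx. Qed.

Lemma qn0 : qn 0 = 0.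
Proof. by rewrite /qn !mulr0 subrr mulr0. Qed.

Lemma wgtM xi j : wgt xi j * wgt (~~ xi) j = 1.
Proof.
rewrite /wgt mulrACA mulrNN -expr2 sqrr_sign mul1r -expfzDr ?cexp_neq0 //.
by case: xi; rewrite /= ?opprK ?subrr ?addNr.
Qed.

Lemma sgT : (sg true)%:~R = 1 :> C. Proof. by []. Qed.
Lemma sgF : (sg false)%:~R = - 1 :> C. Proof. by []. Qed.

Lemma cre_Clq : is_Clq_module h cre num.
Proof.
split.
- by move=> xi i; apply: linP => a u v r; rewrite !creE fvalD fvalZ; ring.
- by move=> i; apply: (diag_linear (numE i)).
- by move=> i; apply: (diag_diag (numE i)).
- move=> i j f; apply: fockP => r; rewrite /commx fvalB fvalZ !numE fval0; ring.
- move=> xi i j f; apply: fockP => r; rewrite /commx fvalB !fvalZ numE !creE numE.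
  rewrite /sh ffunE; case: eqP => [->|_]; last by rewrite mulr0n; ring.
  case: xi; rewrite ?sgT ?sgF ?mulr1n /=; last by rewrite -natr1; ring.
  by rewrite /amp; case: (r j) => [|x]; rewrite /= ?mul0r ?mulr0 ?subrr //
    -natr1; ring.
- move=> i f; apply: fockP => r; rewrite fvalZ (diag_qbracket (numE i)) !creE.
  rewrite (cum_sh_ge _ _ (leqnn i)) /amp sh_eq -/(qn (r i)) /=.
  case ri: (r i) => [|x]; first by rewrite /= mul0r !mulr0 qn0 mul0r mulr0.
  rewrite /= (@shK true) ?ri //; case: (boolP (_ || _)) => [_|ne]; last first.
    rewrite fval_occ ?(mulr0, mul0r) //.
    apply/forallPn; exists i; rewrite negb_imply ri.
    by move: ne; rewrite negb_or -leqNgt.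
  rewrite mul1r !mulrA -expfzMl wgtM exp1rz mul1r //.
- move=> i f; apply: fockP => r; rewrite fvalZ.
  have AE g r' : fval (g - (-1) ^+ par m i *: num i g) r' =
      (1 - (-1) ^+ par m i * (r' i)%:R) * fval g r'.
    by rewrite fvalB fvalZ numE; ring.
  rewrite (diag_qbracket AE) !creE (cum_sh_ge _ _ (leqnn i)) (@shK false) //.
  rewrite /amp sh_eq /=.
  transitivity (c_q h * (qn (r i).+1 * ((i < m) || (r i < 1))%N%:R * fval f r)).
    have W : wgt false i ^ cum i r * wgt true i ^ cum i r = 1.
      by rewrite -expfzMl (wgtM false) exp1rz.
    rewrite -[RHS]mul1r -[X in _ = X * _]W; ring.
  congr (_ * _); rewrite /par; have [im|im] := ltnP i m.
    by rewrite /= expr1 mulN1r opprK nat1r mulr1.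
  rewrite /= expr0 mul1r; case ri: (r i) => [|[|x]] /=.
  - by rewrite subr0 [qn 1 * 1]mulr1.
  - by rewrite subrr !mulr0 subrr !(mulr0, mul0r).
  - rewrite fval_occ ?mulr0 //; apply/forallPn; exists i.
    by rewrite negb_imply im ri.
- move=> xi eta i j f ij; apply: fockP => r; rewrite fvalZ !creE.
  have nij : i != j by apply: contraTneq ij => ->; rewrite ltnn.
  have nji : j != i by rewrite eq_sym.
  rewrite (cum_sh_ge _ _ (ltnW ij)) !amp_sh // (sh_comm _ _ _ nji).
  have [H|H] := boolP (xi && (r i == 0%N)).
    by case/andP: H => -> /eqP ri; rewrite /amp ri /= !(mul0r, mulr0).
  rewrite (cum_sh_lt ij H) expfzDr ?wgt_neq0 //.
  have -> : wgt eta j ^ (- sg xi) =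
      - (-1) ^+ par m j * cexp h ^ (sg xi * sg eta).
    rewrite /wgt expfzMl exprz_exp mulrNN mulrC [sg eta * _]mulrC mulrC.
    by congr (_ * _); rewrite /par; case: (j < m)%N; case: xi {H};
      rewrite /= ?expr1 ?expr0 ?opprK ?exp1rz // ?exprN1 ?invrN1 // expr1z.
  by ring.
- move=> xi i f mi; apply: fockP => r; rewrite !creE fval0.
  case: xi; last first.
    rewrite (@fval_occ f) ?mulr0 //; apply/forallPn; exists i.
    by rewrite negb_imply mi !sh_eq.
  have im : (i < m)%N = false by rewrite ltnNge mi.
  by rewrite /amp !sh_eq im; case: (r i) => [|[|x]]; rewrite /= !(mul0r, mulr0).
Qed.

Definition vac0 : fockT := dlt [ffun=> 0%N].

Lemma occ0 : occupation ([ffun=> 0%N] : occ).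
Proof. by apply/forallP => i; rewrite ffunE implybT. Qed.

Lemma ket_dlt r : occupation r -> ket cre vac0 r = dlt r.
Proof.
move=> ro.
(* restriction of r to the indices in s *)
pose res (s : seq 'I_N) : occ := [ffun a => if a \in s then r a else 0%N].
have reso s : occupation (res s).
  apply/forallP => i; apply/implyP => mi; rewrite ffunE; case: ifP => // _.
  by have /forallP/(_ i)/implyP := ro; apply.
suff H s : sorted ltn (map val s) ->
    foldr (fun i => iter (r i) (cre true i)) vac0 s = dlt (res s).
  rewrite /ket H; first by congr dlt; apply/ffunP => a; rewrite ffunE mem_enum.
  by rewrite val_enum_ord iota_ltn_sorted.
elim: s => [_|i s IH /= si].
  by congr dlt; apply/ffunP => a; rewrite !ffunE.
rewrite IH; last exact: path_sorted si.
have si' a : a \in s -> (i < a)%N.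
  by move=> /(map_f val); apply/allP; apply: order_path_min si; exact: ltn_trans.
have is_ : i \notin s by apply/negP => /si'; rewrite ltnn.
pose rt t : occ := upd (res s) i t.
have rto t : (t <= r i)%N -> occupation (rt t).
  move=> tr; apply/forallP => a; apply/implyP => ma; rewrite ffunE.
  case: eqP => [ai|_]; last by have /forallP/(_ a)/implyP := reso s; apply.
  apply: leq_trans tr _; rewrite -ai.
  by have /forallP/(_ a)/implyP := ro; apply.
suff E t : (t <= r i)%N -> iter t (cre true i) (dlt (res s)) = dlt (rt t).
  rewrite E //; congr dlt; apply/ffunP => a; rewrite !ffunE inE.
  by case: eqP => [->|].
elim: t => [_|t IHt tr].
  congr dlt; apply/ffunP => a; rewrite !ffunE; case: eqP => [->|//].
  by rewrite (negPf is_).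
rewrite iterS IHt; last exact: ltnW.
apply: fockP => r'; rewrite creE /=.
have [rE|rN] := eqVneq r' (rt t.+1).
  have -> : sh true i r' = rt t.
    apply/ffunP => a; rewrite rE /sh !ffunE eqxx.
    by case: eqP.
  rewrite !eqxx (rto t (ltnW tr)) rE (rto t.+1 tr) ?eqxx.
  rewrite /cum big1 => [|a ai]; last first.
    rewrite !ffunE; case: eqP => [E|_]; first by rewrite E ltnn in ai.
    by case: ifP => // /si'; rewrite ltnNge ltnW.
  rewrite expr0z mul1r mulr1 /amp ffunE eqxx /=.
  suff -> : (i < m)%N || (t < 1)%N by [].
  have [//|im] := ltnP i m.
  rewrite /=; apply: leq_trans tr _.
  by have /forallP/(_ i)/implyP := ro; apply.
have [ri|ri] := eqVneq (r' i) 0%N; first by rewrite /amp ri /= mul0r mulr0.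
case: eqP => [E|_]; last by rewrite /= !mulr0.
case/eqP: rN; have <- := @shK true i r'; last by rewrite (negPf ri).
rewrite E; apply/ffunP => a; rewrite /sh !ffunE eqxx.
by case: eqP.
Qed.

Lemma model_Fock : is_Fock h cre num vac0.
Proof.
split; first exact: cre_Clq.
- move=> i; apply: fockP => r; rewrite creE fval0 /=.
  case: eqP => [/ffunP/(_ i)|]; last by rewrite !mulr0.
  by rewrite sh_eq ffunE.
- move=> i; apply: fockP => r; rewrite numE fval0 /=.
  by case: eqP => [->|]; rewrite ?mulr0 // ffunE mul0r.
split=> [s f us os|v].
  rewrite big_seq (eq_bigr (fun r => f r *: dlt r)) -?big_seq => [s0 i si|r rs].
    have := congr1 (fun g => fval g i) s0; rewrite fval_sum fval0.
    under eq_bigr do rewrite fvalZ dltE.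
    rewrite (bigD1_seq i) //= (allP os) // eqxx mulr1 big1 ?addr0 // => r.
    by rewrite eq_sym => /negPf ->; rewrite mulr0.
  by rewrite ket_dlt // (allP os).
have [s [_ so ->]] := dlt_decomp v; rewrite big_seq rpred_sum // => r rs.
rewrite rpredZ // mem_lspan //; exists r; first by rewrite /= (allP so).
by rewrite ket_dlt // (allP so).
Qed.

End Model.

Lemma Fock_exists (R : realType) (h : R[i]) (m n : nat) :
  exists (F : lmodType R[i]) (c : bool -> 'I_(m + n) -> F -> F)
    (Nop : 'I_(m + n) -> F -> F) (vac : F), is_Fock h c Nop vac.
Proof.
exists (fockT R m n), (cre h), (@num _ _ _), (vac0 R m n); exact: model_Fock.
Qed.

End FockModel.

(* Main.v *)
(** The relations of U_q[osp(2n+1|2m)] hold in every Cl_q(n|m)-module in which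
q^2 <> 1: by the exchange relations [[c_i^eta, c_{i'}^{-eta}]], with
i' = i + xi, is (up to sign) (1 + q^xi) times an ordered product, so each
triple relation is an identity between the two operators q^{+N_j}, q^{-N_j}.

On the truncated Fock space the kets with r_i < k for i <= m form a basis.
Creation operators move kets by a phase, so c_i^- c_i^+ = c_q [1 -+ N_i] gives
the annihilation coefficients: [r] with 0 < r < k, which is nonzero as l and k
are coprime.  Hence a nonzero vector killed by every c_i^- is a multiple of the
vacuum, and any nonzero submodule contains the vacuum.  When l = 1 these
numbers [r] are positive, and the kets are orthogonal with squared norm the
product of the c_q [r] met on the way up from the vacuum. *)

Require Import Defs.
From HB Require Import structures.
From mathcomp Require Import all_boot all_order all_algebra.
From mathcomp Require Import ring_quotient sesquilinear complex.
From mathcomp Require Import all_classical all_reals all_analysis.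
From mathcomp Require Import ring.
Import Order.TTheory GRing.Theory Num.Theory.
Local Open Scope ring_scope.
Local Open Scope complex_scope.
Set Implicit Arguments.
Unset Strict Implicit.
Unset Printing Implicit Defensive.

(** * From Clifford modules to osp modules *)

Section CliffordToOsp.
Context (R : realType).
Local Notation C := R[i].

(** An eigenvector decomposition for [A] is also one for a + bA, with eigenvalues moved affinely.
    This reduces q^{H_i} and [1 -+ N_i] to q^{N_i} and q^{-N_i}. *)
Lemma expop_affine (V : lmodType C) (A : V -> V) (x a b : C) (v : V) :
  linear A -> is_diagonalizable A ->
  expop x (fun u => a *: u + b *: A u) v = cexp (x * a) *: expop (x * b) A v.
Proof.
move=> lA dA; have [s sP] := dA v; have [sA vs] := sP.
have lB : linear (fun u => a *: u + b *: A u).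
  move=> y u w; rewrite lA !scalerDr !scalerA [y * a]mulrC [y * b]mulrC.
  by rewrite addrACA.
rewrite (expopE lA _ sP) scaler_sumr.
rewrite (@expopE _ _ _ lB x v [seq (a + b * p.1, p.2) | p <- s]).
  rewrite big_map; apply: eq_bigr => p _ /=.
  by rewrite scalerA -cexpD mulrDr mulrA.
split; last by rewrite big_map.
by move=> _ /mapP[p /sA pA ->] /=; rewrite pA scalerA -scalerDl.
Qed.

Context (h : C) (m n : nat) (V : lmodType C).
Local Notation N := (m + n)%N.
Local Notation q := (cexp h).
Local Notation t := (cexp (h / 2)).
Context (c : bool -> 'I_N -> V -> V) (Nop : 'I_N -> V -> V).
Hypothesis CV : is_Clq_module h c Nop.
Hypothesis q_neqV : q - q^-1 != 0.

Let lc xi i : linear (c xi i) := Clq_c_linear CV xi i.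
Let lN i : linear (Nop i) := Clq_N_linear CV i.
Let dN i : is_diagonalizable (Nop i) := Clq_N_diag CV i.

Let Ep i v := expop h (Nop i) v.
Let Em i v := expop (- h) (Nop i) v.

(** The relations below become identities between the coefficients of P = q^{N_i} v and M = q^{-N_i}
    v. *)
Let comb (P M : V) (z w a b a' b' : C) :
  z *: (a *: P + b *: M) + w *: (a' *: P + b' *: M) =
  (z * a + w * a') *: P + (z * b + w * b') *: M.
Proof. by rewrite !scalerDr !scalerA addrACA -!scalerDl. Qed.

Let t0 : t != 0 := cexp_neq0 (h / 2).
Let qE : q = t * t. Proof. by rewrite -cexpD; congr cexp; field. Qed.
Let cqE : c_q h = 2 / (t + t^-1). Proof. by rewrite /c_q mulNr cexpN. Qed.

(** With t = q^{1/2}, the condition q^2 <> 1 reads t^4 <> 1; it also keeps the denominator t +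
    t^{-1} of c_q away from zero. *)
Let t4 : (t * t * (t * t) - 1 != 0).
Proof.
have := q_neqV; apply: contraNneq => E; rewrite qE.
have -> : t * t - (t * t)^-1 = (t * t * (t * t) - 1) / (t * t) by field.
by rewrite E mul0r.
Qed.
Let t4E : t * t * (t * t) - 1 = (t * t + 1) * (t * t - 1). Proof. ring. Qed.
Let t2 : t * t + 1 != 0.
Proof. by move: t4; rewrite t4E mulf_eq0 negb_or => /andP[]. Qed.

Let k1 := c_q h / (q - q^-1).

Let cpcm i v : c true i (c false i v) = k1 *: Ep i v + (- k1) *: Em i v.
Proof. by rewrite (Clq_cpcm CV) /qbracket !scalerA scalerDr scalerN scaleNr. Qed.

Let cmcp i v : c false i (c true i v) =
  (k1 * (if (i < m)%N then q else - q^-1)) *: Ep i v +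
  (k1 * (if (i < m)%N then - q^-1 else q)) *: Em i v.
Proof.
rewrite (Clq_cmcp CV) /qbracket.
have -> : (fun u => u - (-1) ^+ par m i *: Nop i u) =
    (fun u => 1 *: u + (- (-1) ^+ par m i) *: Nop i u).
  by apply/funext => u; rewrite scale1r scaleNr.
rewrite !expop_affine // !mulr1 cexpN scalerA scalerDr !scalerA -scaleNr.
rewrite scalerA /Ep /Em /par; case: ifP => _.
  by rewrite expr1 opprK !mulr1.
by rewrite expr0 !mulrN1 opprK addrC.
Qed.

Let Hop i v := (-1) ^+ par m i *: Nop i v - 2^-1 *: v.

Let lH i : linear (Hop i).
Proof.
move=> x u v; rewrite /Hop lN !scalerDr !scalerN !scalerA opprD addrACA.
by rewrite [x * _]mulrC [x * _]mulrC.
Qed.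

Let expH x i v : expop x (Hop i) v =
  cexp (- x / 2) *: expop (x * (-1) ^+ par m i) (Nop i) v.
Proof.
have -> : Hop i = (fun u => (- 2^-1) *: u + (-1) ^+ par m i *: Nop i u).
  by apply/funext => u; rewrite addrC scaleNr.
by rewrite expop_affine // mulrN mulNr.
Qed.

Let expHp i v : expop h (Hop i) v =
  t^-1 *: (if (i < m)%N then Em i v else Ep i v).
Proof.
rewrite expH mulNr cexpN /par; case: ifP => _; first by rewrite mulrN1.
by rewrite mulr1.
Qed.

Let expHm i v : expop (- h) (Hop i) v =
  t *: (if (i < m)%N then Ep i v else Em i v).
Proof.
rewrite expH opprK /par; case: ifP => _; first by rewrite mulrN1 opprK.
by rewrite mulr1.
Qed.

(* Both orders of the exchange relation at once: for i > j it is inverted. *)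
Let exch xi eta i j v : i != j ->
  c xi i (c eta j v) = (- (-1) ^+ par m (if (i < j)%N then j else i) *
    q ^ (if (i < j)%N then sg xi * sg eta else - (sg xi * sg eta))) *:
    c eta j (c xi i v).
Proof.
move=> ij; case: ltngtP => [lt|gt|/val_inj eq].
- exact: (Clq_exchange CV).
- rewrite (Clq_exchange CV eta xi v gt) scalerA mulrACA mulrNN -expr2 sqrr_sign.
  by rewrite [sg eta * _]mulrC -expfzDr ?cexp_neq0 // addNr mul1r scale1r.
- by rewrite eq eqxx in ij.
Qed.
Let cZ xi i a v : c xi i (a *: v) = a *: c xi i v. Proof. exact: linZ. Qed.

Let c0 xi i : c xi i 0 = 0.
Proof. by rewrite -[X in c _ _ X](scale0r 0) cZ scale0r. Qed.

(** Both sides are combinations of q^{N_i} v and q^{-N_i} v, whose coefficients agree because c_q =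
    2/(t + t^{-1}). For bosons the two exponentials swap roles, since there H_i = -N_i - 1/2. *)
Lemma osp_aa i v : scommx (par m i) (par m i) 1 (c false i) (c true i) v =
    - (2 / (q - q^-1)) *: (expop h (Hop i) v - expop (- h) (Hop i) v).
Proof.
rewrite /scommx /commx cpcm cmcp expHp expHm mulr1 -scaleNr.
have -> x (P M : V) : - x *: (t^-1 *: P - t *: M) = (- x * t^-1) *: P + (x * t) *: M.
  by rewrite scalerBr !scalerA -[X in _ + X]scaleNr [- x * t]mulNr opprK.
rewrite -[X in X + _]scale1r comb !mul1r /k1 cqE qE /par; case: ifP => _ /=.
  rewrite expr1 addrC; congr (_ *: _ + _ *: _); field; by rewrite t0 t2 t4.
rewrite expr0; congr (_ *: _ + _ *: _); field; by rewrite t0 t2 t4.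
Qed.

Let Q (b : bool) : C := if b then q else q^-1.

Let Q_sg xi eta : q ^ (sg xi * sg eta) = Q (xi == eta).
Proof. by case: xi; case: eta. Qed.

(** Indices of parity 1 come first, so the larger index has parity 1 exactly when both do; this
    makes the sign symmetric in i and j. *)
Let exchQ xi eta i j v : i != j ->
  c xi i (c eta j v) = ((if (i < m)%N && (j < m)%N then 1 else -1) *
    Q ((i < j)%N == (xi == eta))) *: c eta j (c xi i v).
Proof.
move=> ij; rewrite exch //; congr ((_ * _) *: _).
  rewrite /par; case: (ltnP i j) => ij'.
    rewrite [(i < m)%N && _]andb_idl => [|/(ltn_trans ij') //].
    by case: (j < m)%N; rewrite /= ?expr1 ?expr0 ?opprK.
  rewrite [(i < m)%N && _]andb_idr => [|/(leq_ltn_trans ij') //].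
  by case: (i < m)%N; rewrite /= ?expr1 ?expr0 ?opprK.
by case: (i < j)%N; rewrite -1?mulNr -?Q_sg //; case: xi; case: eta.
Qed.

(** The exchange sign is opposite to the sign (-1)^{deg deg} of the supercommutator, so the two
    orderings add up to one product with factor 1 + q^{+-1}. *)
Let osp_quad xi eta (i j : 'I_N) v : i != j ->
  scommx (par m i) (par m j) 1 (c xi i) (c eta j) v =
  ((if (i < m)%N && (j < m)%N then 1 else -1) *
    (1 + Q ((i < j)%N == (xi == eta)))) *: c eta j (c xi i v).
Proof.
move=> nij; rewrite /scommx /commx mulr1 exchQ // -scalerBl; congr (_ *: _).
rewrite /par; case: (i < m)%N; case: (j < m)%N; rewrite /= ?muln0 ?muln1 ?expr1 ?expr0; ring.
Qed.

(** After reordering, both terms are multiples of c_j c_j c_i. For fermionic j this vanishes; for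
    bosonic j the factor q in c_i c_j = q c_j c_i matches the parameter of the outer bracket. *)
Lemma osp_serre xi (i j : 'I_N) : i.+1 = j -> j.+1 = N ->
  commx (q ^ (- (-1) ^+ par m j))
    (scommx (par m i) (par m j) 1 (c xi i) (c xi j)) (c xi j) =1 fun=> 0.
Proof.
move=> ij _ v; have lij : (i < j)%N by rewrite -ij.
have nij : i != j by apply: contraTneq lij => ->; rewrite ltnn.
rewrite /commx !osp_quad // !cZ [c xi i (c xi j v)]exchQ // cZ scalerA scalerA -scalerBl.
have [jm|jm] := leqP m j; first by rewrite (Clq_nilpotent CV) // scaler0.
rewrite (_ : _ - _ = 0) ?scale0r // lij eqxx /par jm (ltn_trans lij jm) /= expr1 opprK.
by rewrite expr1z; ring.
Qed.


(** The inner bracket is a multiple of c_{i'}^{-eta} c_i^eta; the cases are j = i', j = i, and j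
    different from both. *)
Lemma osp_triple xi eta (i i' j : 'I_N) v : shifted xi i i' ->
    scommx (par m i + par m i') (par m j)
      (q ^ (- sg xi * (-1) ^+ par m i * (i == j)%:R))
      (scommx (par m i) (par m i') 1 (c eta i) (c (~~ eta) i')) (c eta j) v =
    (2 * (sg eta)%:~R ^+ par m j * (j == i')%:R) *:
      expop (- (sg xi * sg eta)%:~R * h) (Hop j) (c eta i v).
Proof.
move=> sh.
have lt : (i < i')%N = xi.
  by move: sh; rewrite /shifted; case: xi => ->; rewrite ?ltnSn // ltnNge leqnSn.
have nij : i != i'.
  by move: sh; rewrite /shifted; case: xi {lt} => E; apply/eqP => F;
    move: E; rewrite F => /eqP; rewrite ?(gtn_eqF (ltnSn _)) ?(ltn_eqF (ltnSn _)).
(* Opposite signs at i and i' give the exchange factor q^{-xi}. *)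
have fE : (xi == (eta == ~~ eta)) = ~~ xi by case: xi {sh lt}; case: eta.
rewrite {1}/scommx /commx !osp_quad // cZ lt fE.
set s0 : C := if _ then 1 else -1.
have [jE|ji'] := eqVneq j i'.
  rewrite {j}jE (negPf nij) mulr0 expr0z !mulr1.
  (* Moving c_i^eta to the right leaves the two orderings of c_{i'}^+ and c_{i'}^- acting on c_i^eta
     v. *)
  rewrite [c eta i (c eta i' v)]exchQ // cZ lt eqxx eqb_id -/s0.
  set w := c eta i v; rewrite !scalerA.
  have s0E : s0 * s0 = 1 by rewrite /s0; case: ifP; rewrite ?mulN1r ?opprK ?mulr1.
  have yE : (-1) ^+ ((par m i + par m i') * par m i') = - (s0 * (-1) ^+ par m i').
    rewrite /s0 /par; case: (i < m)%N; case: (i' < m)%N;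
    by rewrite /= ?muln0 ?expr1 ?expr0 ?expr2; ring.
  have rE (b : bool) : (sg b)%:~R ^+ par m i' = if b || (m <= i')%N then 1 else -1 :> C.
    by rewrite /par; case: b; case: leqP => //=; rewrite ?expr1n ?expr1 ?expr0.
  have E1 z y : s0 * z * (s0 * y) = z * y by rewrite -[RHS]mul1r -s0E; ring.
  have E2 z y : - (- (s0 * y) * (s0 * z)) = z * y by rewrite -[RHS]mul1r -s0E; ring.
  rewrite yE -scaleNr rE E1 E2 {E1 E2 rE yE}.
  (* In each case one of q^{N_j} w and q^{-N_j} w has coefficient zero, and the other gives L_j^{-xi
     eta}. *)
  have combP a b z P M : a = z -> b = 0 -> a *: P + b *: M = z *: P :> V.
    by move=> -> ->; rewrite scale0r addr0.
  have combM a b z P M : a = 0 -> b = z -> a *: P + b *: M = z *: M :> V.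
    by move=> -> ->; rewrite scale0r add0r.
  have gi : (m <= i')%N = ~~ (i' < m)%N by rewrite leqNgt.
  case: eta @w fE => w _ /=; rewrite cpcm cmcp comb ?gi {gi}; case: xi {sh lt} => /=;
  rewrite ?mulr1 ?mulrN1 ?mulN1r ?opprK ?mul1r ?expHp ?expHm ?scalerA /par;
  case: (i' < m)%N; (apply: combP || apply: combM);
  rewrite /k1 cqE qE ?expr1 ?expr0 /=; field; rewrite ?t0 ?t2 ?t4 //.
have QV b : Q b * Q (~~ b) = 1.
  by case: b; rewrite /Q /= (mulfV, mulVf) ?cexp_neq0.
(* Now j <> i', so the right-hand side vanishes. For j = i the left-hand side is zero by nilpotency
   (fermions) or by q^xi q^{-xi} = 1 (bosons). *)
rewrite mulr0 scale0r; have [jE|ji] := eqVneq j i.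
  rewrite {j ji'}jE [c eta i (c (~~ eta) i' _)]exchQ // lt fE -/s0 !scalerA.
  have [mi|im] := leqP m i; first by rewrite (Clq_nilpotent CV) // c0 !scaler0 subrr.
  rewrite -scalerBl (_ : _ - _ = 0) ?scale0r // mulr1 /par im /s0 im expr1 mulrN1 opprK muln1.
  have -> : q ^ sg xi = Q xi by case: (xi).
  have Q0 : 1 - Q xi * Q (~~ xi) = 0 by rewrite QV subrr.
  case: (i' < m)%N => /=; rewrite ?expr1 ?expr2.
    by transitivity ((1 + Q (~~ xi)) * (1 - Q xi * Q (~~ xi)));
      [ring | rewrite Q0 mulr0].
  by transitivity (- (1 + Q (~~ xi)) * (1 - Q xi * Q (~~ xi)));
    [ring | rewrite Q0 mulr0].
(* Being adjacent, i and i' lie on the same side of any other j, so the powers of q from moving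
   c_j^eta past c_i^eta and c_{i'}^{-eta} cancel. *)
have jlt : (i < j)%N = (i' < j)%N.
  have nE (a b : 'I_N) : a != b -> (a == b :> nat) = false by move=> /negPf.
  move: sh (nE _ _ ji) (nE _ _ ji'); rewrite /shifted; case: xi {lt fE} => -> E1 E2.
    by rewrite [RHS]ltn_neqAle eq_sym E2.
  by rewrite [LHS]ltn_neqAle eq_sym E1.
rewrite [c eta i (c eta j v)]exchQ 1?eq_sym // cZ.
rewrite [c (~~ eta) i' (c eta j _)]exchQ 1?eq_sym // !scalerA.
rewrite -scalerBl (_ : _ - _ = 0) ?scale0r // mulr0 expr0z mulr1 jlt eqxx.
have -> : (~~ eta == eta) = false by case: (eta).
rewrite eqbF_neg eqb_id.
set S := s0 * _; set x := Q _; set y := Q _.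
have Q0 : x * y - 1 = 0 by rewrite QV subrr.
transitivity (S * (-1) ^+ ((par m i + par m i') * par m j) * (x * y - 1)); last first.
  by rewrite Q0 mulr0.
rewrite /par; case: (i < m)%N; case: (i' < m)%N; case: (j < m)%N;
  rewrite /= ?muln0 ?muln1 ?expr1 ?expr0 ?expr2; ring.
Qed.

Lemma osp_of_Clq : is_Uq_osp_module h c Hop.
Proof.
split.
- by move=> xi i; apply: lc.
- exact: lH.
- move=> i v; have [s [sN vs]] := dN i v.
  exists [seq ((-1) ^+ par m i * p.1 - 2^-1, p.2) | p <- s].
  split; last by rewrite big_map.
  by move=> _ /mapP[p /sN pN ->] /=; rewrite /Hop pN scalerA -scalerBl.
- move=> i j v; have := Clq_NN CV i j v; rewrite /commx /Hop !scale1r.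
  have NB k u w : Nop k (u - w) = Nop k u - Nop k w.
    by rewrite addrC -scaleN1r lN scaleN1r addrC.
  rewrite !NB !(linZ (lN _)) => /eqP; rewrite subr_eq0 => /eqP E.
  rewrite !scalerBr !scalerA E [_ * (-1) ^+ par m j]mulrC.
  rewrite [_ ^+ par m i / 2]mulrC [_ ^+ par m j / 2]mulrC; apply/eqP; rewrite subr_eq0; apply/eqP.
  rewrite !opprB addrACA [in RHS]addrACA; congr (_ + _); exact: addrC.
- move=> xi i j v; have := Clq_Nc CV xi i j v; rewrite /commx /Hop !scale1r => E.
  have cB u w : c xi j (u - w) = c xi j u - c xi j w.
    by rewrite addrC -scaleN1r lc scaleN1r addrC.
  rewrite cB !cZ opprB addrA subrK -scalerBr E scalerA.
  by congr (_ *: _); rewrite mulrC.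
- exact: osp_aa.
- exact: osp_serre.
- exact: osp_triple.
Qed.

End CliffordToOsp.

(** * Quotients of Clifford modules *)

Section QuotientOperators.
Context (R : realType).
Local Notation C := R[i].
Context (V : lmodType C) (S : set V).
Local Notation I := (lspan S : zmodClosed V).
Local Notation pi := (@lquot_pi _ V S).

Lemma lquot_pi_linear : linear pi.
Proof. by move=> a u v; rewrite lquot_piD -lquot_piZ. Qed.

HB.instance Definition _ := GRing.isLinear.Build C V (lquot S) _ pi lquot_pi_linear.

Let piB u v : pi (u - v) = pi u - pi v. Proof. exact: linearB. Qed.
Let piZ a v : pi (a *: v) = a *: pi v. Proof. exact: linearZ. Qed.

Lemma lquot_pi_surj (x : lquot S) : exists v, x = pi v.
Proof. by exists (lquot_repr x); rewrite lquot_reprK. Qed.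

Section OneOperator.
Context (A : V -> V).
Hypothesis lA : linear A.
Hypothesis IA : forall v, v \in I -> A v \in I.

Lemma lquot_op_linear : linear (lquot_op (S := S) A).
Proof.
move=> a x y; have [u ->] := lquot_pi_surj x; have [v ->] := lquot_pi_surj y.
by rewrite -linearP !lquot_opE // lA linearP.
Qed.

Lemma lquot_eigen_decomp v s : eigen_decomp A v s ->
  eigen_decomp (lquot_op (S := S) A) (pi v) [seq (p.1, pi p.2) | p <- s].
Proof.
move=> [sA ->]; split; last by rewrite linear_sum big_map.
by move=> _ /mapP[p /sA pA ->] /=; rewrite lquot_opE // pA linearZ.
Qed.

Lemma lquot_diagonalizable :
  is_diagonalizable A -> is_diagonalizable (lquot_op (S := S) A).
Proof.
move=> dA x; have [v ->] := lquot_pi_surj x; have [s sP] := dA v.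
by eexists; exact: lquot_eigen_decomp sP.
Qed.

(** [expop] may be computed from any eigenvector decomposition, in particular from the projection of
    one upstairs. *)
Lemma lquot_expop x v : is_diagonalizable A ->
  expop x (lquot_op (S := S) A) (pi v) = pi (expop x A v).
Proof.
move=> /(_ v)[s sP]; rewrite (expopE lA x sP) linear_sum.
rewrite (expopE lquot_op_linear x (lquot_eigen_decomp sP)) big_map.
by apply: eq_bigr => p _; rewrite linearZ.
Qed.

Lemma lquot_qbracket h v : is_diagonalizable A ->
  qbracket h (lquot_op (S := S) A) (pi v) = pi (qbracket h A v).
Proof. by move=> dA; rewrite /qbracket !lquot_expop // piZ piB. Qed.

End OneOperator.

Lemma lquot_Clq (h : C) (m n : nat) (c : bool -> 'I_(m + n) -> V -> V)
    (Nop : 'I_(m + n) -> V -> V) :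
  is_Clq_module h c Nop ->
  (forall xi i v, v \in I -> c xi i v \in I) ->
  (forall i v, v \in I -> Nop i v \in I) ->
  is_Clq_module h (fun xi i => lquot_op (S := S) (c xi i))
    (fun i => lquot_op (S := S) (Nop i)).
Proof.
move=> CV Ic IN.
have cE xi i v : lquot_op (c xi i) (pi v) = pi (c xi i v).
  exact: (lquot_opE (Clq_c_linear CV xi i) (Ic xi i)).
have NE i v : lquot_op (Nop i) (pi v) = pi (Nop i v).
  exact: (lquot_opE (Clq_N_linear CV i) (IN i)).
split.
- move=> xi i; exact: (lquot_op_linear (Clq_c_linear CV xi i) (Ic xi i)).
- move=> i; exact: (lquot_op_linear (Clq_N_linear CV i) (IN i)).
- move=> i; exact: (lquot_diagonalizable (Clq_N_linear CV i) (IN i) (Clq_N_diag CV i)).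
- move=> i j x; have [v ->] := lquot_pi_surj x.
  by have := Clq_NN CV i j v; rewrite /commx !NE !scale1r -piB => ->; rewrite linear0.
- move=> xi i j x; have [v ->] := lquot_pi_surj x.
  have := Clq_Nc CV xi i j v; rewrite /commx !(NE, cE) !scale1r -piB => ->.
  by rewrite piZ.
- move=> i x; have [v ->] := lquot_pi_surj x.
  rewrite !cE (lquot_qbracket (Clq_N_linear CV i) (IN i) _ _ (Clq_N_diag CV i)).
  by rewrite (Clq_cpcm CV) piZ.
- move=> i x; have [v ->] := lquot_pi_surj x.
  set A := fun u => u - (-1) ^+ par m i *: Nop i u.
  have lA : linear A.
    move=> a u w; rewrite /A (Clq_N_linear CV) !scalerDr !scalerN opprD !scalerA.
    by rewrite [a * _]mulrC addrACA.
  have IA w : w \in I -> A w \in I.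
    by move=> Iw; rewrite rpredB // rpredZ // IN.
  have dA : is_diagonalizable A.
    move=> w; have [s [sN ws]] := Clq_N_diag CV i w.
    exists [seq (1 - (-1) ^+ par m i * p.1, p.2) | p <- s].
    split; last by rewrite big_map.
    move=> _ /mapP[p /sN pN ->] /=.
    by rewrite /A pN scalerA scalerBl scale1r.
  (* The operator inside [1 -+ N_i] is itself induced from [V], so its bracket descends too. *)
  have -> : (fun u => u - (-1) ^+ par m i *: lquot_op (Nop i) u) = lquot_op (S := S) A.
    apply/funext => y; have [w ->] := lquot_pi_surj y.
    by rewrite NE lquot_opE // /A piB piZ.
  by rewrite !cE lquot_qbracket // (Clq_cmcp CV) piZ.
- move=> xi eta i j x ij; have [v ->] := lquot_pi_surj x.
  by rewrite !cE (Clq_exchange CV) // piZ.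
- move=> xi i x mi; have [v ->] := lquot_pi_surj x.
  by rewrite !cE (Clq_nilpotent CV) // linear0.
Qed.

End QuotientOperators.

(** * q-numbers at a root of unity *)

Section RootOfUnity.
Context (R : realType) (l k : nat).
Hypotheses (l_gt0 : (0 < l)%N) (k_gt0 : (0 < k)%N) (l_lt_k : (l < k)%N).
Local Notation C := R[i].
Local Notation h := (qexponent R l k).
Local Notation theta := (pi * l%:R / k%:R : R).

Let qexpR (x : R) : h * x%:C = 0 +i* (theta * x).
Proof.
by apply/eqP; rewrite eq_complex /= !(mul0r, mul1r, mulr0, subr0, addr0, add0r, oppr0) !eqxx.
Qed.

Let cexp_im (x : R) : cexp (0 +i* x) = cos x +i* sin x.
Proof. by apply/eqP; rewrite /cexp eq_complex /= expR0 !(mul0r, mul1r, subr0, addr0) !eqxx. Qed.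

Let cexp_hR (x : R) : cexp (h * x%:C) = cos (theta * x) +i* sin (theta * x).
Proof. by rewrite qexpR cexp_im. Qed.

Let cexp_hN (x : R) : cexp (- h * x%:C) = cos (theta * x) -i* sin (theta * x).
Proof. by rewrite mulNr -mulrN -raddfN /= cexp_hR mulrN cosN sinN. Qed.

Let cexp_h : cexp h = cos theta +i* sin theta.
Proof. by rewrite -[h]mulr1 -[1]/(1%:C) cexp_hR mulr1. Qed.

Let cexp_hV : (cexp h)^-1 = cos theta -i* sin theta.
Proof. by rewrite -cexpN -[- h]mulr1 -[1]/(1%:C) cexp_hN mulr1. Qed.

Lemma norm_cexp_qexponent : `|cexp h| = 1.
Proof. by rewrite cexp_h normc_def /= cos2Dsin2 sqrtr1. Qed.

Let theta_gt0 : 0 < theta.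
Proof. by rewrite !mulr_gt0 ?pi_gt0 ?invr_gt0 ?ltr0n. Qed.

Let theta_lt_pi : theta < pi.
Proof.
by rewrite -mulrA gtr_pMr ?pi_gt0 // ltr_pdivrMr ?ltr0n // mul1r ltr_nat.
Qed.

Let sin_theta_gt0 : 0 < sin theta.
Proof. by apply: sin_gt0_pi; rewrite theta_gt0 theta_lt_pi. Qed.

Let subJ (x y : R) : (x +i* y) - (x -i* y) = 0 +i* (y + y).
Proof. by apply/eqP; rewrite eq_complex /= subrr opprK !eqxx. Qed.

Lemma qexponent_neqV : cexp h - (cexp h)^-1 != 0.
Proof.
rewrite cexp_hV cexp_h subJ eq_complex /= eqxx /=.
by rewrite gt_eqF // addr_gt0.
Qed.

(** Numerator and denominator are purely imaginary: 2i sin(theta x) and 2i sin(theta), with theta =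
    pi l / k. *)
Lemma qn_qexponent (x : nat) :
  FockModel.qn h x = (sin (theta * x%:R) / sin theta)%:C.
Proof.
have xC : (x%:R : C) = (x%:R)%:C by rewrite rmorph_nat.
rewrite /FockModel.qn xC cexp_hR cexp_hN cexp_hV cexp_h !subJ.
set a := sin theta; set b := sin _.
have a0 : a != 0 by rewrite gt_eqF.
have a2 : 0 +i* (a + a) != 0 :> C.
  by rewrite eq_complex /= eqxx gt_eqF // addr_gt0.
apply: (mulfI a2); rewrite mulrA mulfV // mul1r.
apply/eqP; rewrite eq_complex /= !(mul0r, mulr0, addr0, add0r, oppr0) eqxx /=.
by rewrite mulrDl mulrCA divff // mulr1.
Qed.

(** Here c_q is the reciprocal of cos(theta / 2), and 0 < theta / 2 < pi / 2. *)
Lemma c_q_qexponent_gt0 : 0 < c_q h.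
Proof.
have E : c_q h = ((cos (theta / 2))^-1)%:C.
  rewrite /c_q.
  have -> : (2 : C)^-1 = (2^-1)%:C by rewrite fmorphV /= rmorph_nat.
  rewrite cexp_hR cexp_hN.
  set x := cos _; set y := sin _.
  have -> : (x +i* y) + (x -i* y) = x%:C * 2.
    rewrite mulr_natr mulr2n; apply/eqP.
    by rewrite eq_complex /= subrr addr0 !eqxx.
  by rewrite fmorphV /= invfM mulrCA mulfV ?mulr1.
rewrite E ltcR invr_gt0; apply: cos_gt0_pihalf.
apply/andP; split; last by rewrite ltr_pM2r ?invr_gt0.
by apply: (@lt_trans _ _ 0); rewrite ?oppr_lt0 divr_gt0 ?pi_gt0.
Qed.

Lemma qn1_qexponent : FockModel.qn h 1 = 1.
Proof. by rewrite qn_qexponent mulr1 divff // gt_eqF. Qed.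

Let sinDnatpi (a : nat) (x : R) : sin (pi * a%:R + x) = (-1) ^+ a * sin x.
Proof.
elim: a => [|a IH]; first by rewrite mulr0 add0r mul1r.
by rewrite -natr1 mulrDr mulr1 addrAC sinDpi IH exprS mulN1r mulNr.
Qed.

Let sin_pi_frac (b : nat) : (0 < b)%N -> (b < k)%N -> 0 < sin (pi * b%:R / k%:R : R).
Proof.
move=> b0 bk; apply: sin_gt0_pi; apply/andP; split.
  by rewrite !mulr_gt0 ?pi_gt0 ?invr_gt0 ?ltr0n.
by rewrite -mulrA gtr_pMr ?pi_gt0 // ltr_pdivrMr ?ltr0n // mul1r ltr_nat.
Qed.

(** Division of l x by k gives sin(theta x) = +-sin(pi r / k) with r = l x mod k; coprimality and 0
    < x < k exclude r = 0. *)
Lemma qn_qexponent_neq0 (x : nat) :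
  coprime l k -> (0 < x)%N -> (x < k)%N -> FockModel.qn h x != 0.
Proof.
move=> lk x0 xk; rewrite qn_qexponent fmorph_eq0 mulf_neq0 //; last first.
  by rewrite invr_neq0 // gt_eqF.
have -> : theta * x%:R = pi * (l * x %/ k)%:R + pi * (l * x %% k)%:R / k%:R.
  have k0 : (k%:R : R) != 0 by rewrite pnatr_eq0 -lt0n.
  have -> : theta * x%:R = pi * (l * x)%:R / k%:R by rewrite natrM; field.
  by rewrite {1}(divn_eq (l * x) k) natrD natrM; field.
rewrite sinDnatpi mulf_neq0 ?signr_eq0 // gt_eqF // sin_pi_frac ?ltn_mod //.
rewrite lt0n; apply: contraTneq xk => /eqP.
rewrite -/(k %| l * x)%N Gauss_dvdr 1?coprime_sym // => /(dvdn_leq x0).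
by rewrite leqNgt.
Qed.

(** For l = 1 the angle is pi x / k, which lies in (0, pi). *)
Lemma qn_qexponent_gt0 (x : nat) :
  l = 1%N -> (0 < x)%N -> (x < k)%N -> 0 < FockModel.qn h x.
Proof.
move=> l1 x0 xk; rewrite qn_qexponent ltcR divr_gt0 //.
have -> : theta * x%:R = pi * x%:R / k%:R by rewrite l1 mulr1 mulrAC.
exact: sin_pi_frac.
Qed.

Lemma cminus_coef_boson (m n : nat) (i : 'I_(m + n)) (t : nat) :
  (i < m)%N -> cminus_coef h i t = c_q h * FockModel.qn h t.+1.
Proof.
by move=> im; rewrite /cminus_coef /par im expr1 mulN1r opprK nat1r.
Qed.

Lemma cminus_coef_fermion (m n : nat) (i : 'I_(m + n)) :
  (m <= i)%N -> cminus_coef h i 0 = c_q h.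
Proof.
move=> mi; rewrite -[RHS]mulr1 -qn1_qexponent.
by rewrite /cminus_coef /par ltnNge mi /= expr0 mul1r subr0.
Qed.

End RootOfUnity.

(** * Coordinate functionals of a basis *)

Section BasisCoordinates.
Context (K : pzRingType) (V : lmodType K) (I : eqType) (P : pred I) (e : I -> V).
Hypothesis Pe : is_basis P e.

Let comb (L : seq (K * I)) : V := \sum_(p <- L) p.1 *: e p.2.
Let coef (L : seq (K * I)) (i : I) : K := \sum_(p <- L | p.2 == i) p.1.

(** Independence in [is_basis] concerns duplicate-free lists, so repeated indices are collected
    first. *)
Let comb_coef (L : seq (K * I)) :
  comb L = \sum_(j <- undup (unzip2 L)) coef L j *: e j.
Proof.
under [RHS]eq_bigr do rewrite scaler_suml big_mkcond.
rewrite exchange_big /= /comb !big_seq; apply: eq_bigr => p pL.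
have pu : p.2 \in undup (unzip2 L) by rewrite mem_undup map_f.
rewrite (bigD1_seq p.2) ?undup_uniq //= eqxx big1 ?addr0 // => j.
by rewrite eq_sym => /negPf ->.
Qed.

Let coef0 (L : seq (K * I)) i : all P (unzip2 L) -> comb L = 0 -> coef L i = 0.
Proof.
move=> PL; rewrite comb_coef => L0.
have [iL|iL] := boolP (i \in undup (unzip2 L)).
  by apply: (proj1 Pe _ _ (undup_uniq _) _ L0) => //; rewrite all_undup.
rewrite /coef big_seq_cond big1 // => p /andP[pL /eqP pi].
by rewrite mem_undup -pi map_f in iL.
Qed.

Let decomp v : exists L : seq (K * I), all P (unzip2 L) /\ v = comb L.
Proof.
have /asboolP[s sP ->] := proj2 Pe v.
elim: s sP => [_|[a u] s IH sP]; first by exists [::]; rewrite /comb !big_nil.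
have [|L [PL LE]] := IH; first by move=> p ps; apply: sP; rewrite inE ps orbT.
have [i /= Pi ui] := sP (a, u) (mem_head _ _).
by exists ((a, i) :: L); rewrite /= Pi /comb !big_cons LE ui.
Qed.

(** One decomposition of each vector is chosen; independence makes its coefficients linear in the
    vector. *)
Lemma basis_coord : exists lam : I -> V -> K,
  (forall i a u v, lam i (a *: u + v) = a * lam i u + lam i v) /\
  (forall i j, P j -> lam i (e j) = (j == i)%:R).
Proof.
have [L LP] := choice decomp.
exists (fun i v => coef (L v) i); split=> [i a u v|i j Pj].
  (* This list represents a u + v - (a u + v) = 0, so all its coefficients are zero. *)
  pose D := [seq (a * p.1, p.2) | p <- L u] ++ L v ++ [seq (- p.1, p.2) | p <- L (a *: u + v)].
  have combZ b M : comb [seq (b * p.1, p.2) | p <- M] = b *: comb M.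
    by rewrite /comb big_map scaler_sumr; apply: eq_bigr => p _; rewrite scalerA.
  have combN M : comb [seq (- p.1, p.2) | p <- M] = - comb M.
    by rewrite /comb big_map -sumrN; apply: eq_bigr => p _; rewrite scaleNr.
  have combD M M' : comb (M ++ M') = comb M + comb M' by rewrite /comb big_cat.
  have D0 : comb D = 0.
    by rewrite !combD combZ combN -!(proj2 (LP _)) addrA subrr.
  have u2 (f : K * I -> K) M : unzip2 [seq (f p, p.2) | p <- M] = unzip2 M.
    by rewrite /unzip2 -map_comp.
  have PD : all P (unzip2 D).
    by rewrite /D /unzip2 !map_cat !all_cat -!/(unzip2 _) !u2 !(proj1 (LP _)).
  have := coef0 i PD D0.
  rewrite /coef /D !big_cat !big_map /= sumrN addrA => /eqP; rewrite subr_eq0.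
  by rewrite mulr_sumr => /eqP.
have D0 : comb ((-1, j) :: L (e j)) = 0.
  by rewrite /comb big_cons -/(comb _) -(proj2 (LP _)) scaleN1r addNr.
have := @coef0 _ i _ D0; rewrite /= Pj (proj1 (LP _)) => /(_ isT).
rewrite /coef big_cons /=; case: eqP => _ /eqP; last by move/eqP.
by rewrite addrC subr_eq0 => /eqP.
Qed.

End BasisCoordinates.

(** * Ladder operators on kets *)

Section FockKets.
Context (R : realType).
Local Notation C := R[i].
Context (h : C) (m n : nat) (V : lmodType C).
Local Notation N := (m + n)%N.
Context (c : bool -> 'I_N -> V -> V) (Nop : 'I_N -> V -> V) (vac : V).
Hypothesis FV : is_Fock h c Nop vac.
Local Notation occ := {ffun 'I_N -> nat}.
Let lc xi i : linear (c xi i) := Clq_c_linear (Fock_Clq FV) xi i.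
Let lN i : linear (Nop i) := Clq_N_linear (Fock_Clq FV) i.
Let cZ xi i a v : c xi i (a *: v) = a *: c xi i v. Proof. exact: linZ. Qed.

Lemma cplus_pass (i j : 'I_N) t : `|cexp h| = 1 -> i != j ->
  exists2 a : C, `|a| = 1 & forall v,
    c true i (iter t (c true j) v) = a *: iter t (c true j) (c true i v).
Proof.
move=> q1 ij.
have [b b1 bP] : exists2 b : C, `|b| = 1 & forall w,
    c true i (c true j w) = b *: c true j (c true i w).
  have sq x : `| - (-1) ^+ x * cexp h ^ (sg true * sg true)| = 1.
    by rewrite normrM normrN normr_sign mul1r.
  case: (ltngtP i j) => [lt|gt|/val_inj eq]; last by rewrite eq eqxx in ij.
    by exists (- (-1) ^+ par m j * cexp h ^ (sg true * sg true)) => // w;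
      apply: (Clq_exchange (Fock_Clq FV)).
  exists (- (-1) ^+ par m i * cexp h ^ (sg true * sg true))^-1.
    by rewrite normfV sq invr1.
  move=> w; rewrite (Clq_exchange (Fock_Clq FV) true true w gt) scalerA mulVf ?scale1r //.
  by rewrite -normr_eq0 sq oner_eq0.
elim: t => [|t [a a1 IH]]; first by exists 1 => [|v]; rewrite ?normr1 ?scale1r.
exists (b * a) => [|v]; first by rewrite normrM b1 a1 mulr1.
by rewrite !iterS bP IH cZ scalerA.
Qed.

(** Sharpens [cplus_ket]: c_i^+ passes only creation operators of smaller index, each contributing a
    phase. The modulus makes the factor invertible and later compatible with the adjoint. *)
Lemma cplus_ket_phase i (r : occ) : `|cexp h| = 1 -> exists2 a : C, `|a| = 1 &
  c true i (ket c vac r) = a *: ket c vac (upd r i (r i).+1).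
Proof.
move=> q1; rewrite /ket.
have step s : i \notin s -> exists2 a : C, `|a| = 1 & forall v,
    c true i (foldr (fun j => iter (r j) (c true j)) v s) =
    a *: foldr (fun j => iter (upd r i (r i).+1 j) (c true j)) (c true i v) s.
  elim: s => [_|j s IH]; first by exists 1 => [|v]; rewrite ?normr1 ?scale1r.
  rewrite inE negb_or => /andP[ij /IH[a a1 aP]].
  have [b b1 bP] := cplus_pass (r j) q1 ij.
  exists (b * a) => [|v]; first by rewrite normrM b1 a1 mulr1.
  rewrite /= bP aP ffunE eq_sym (negPf ij).
  have -> w : iter (r j) (c true j) (a *: w) = a *: iter (r j) (c true j) w.
    by elim: (r j) => //= t ->; rewrite cZ.
  by rewrite scalerA.
have := enum_uniq 'I_N; have /splitPr[s1 s2] := mem_enum 'I_N i.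
rewrite cat_uniq /= negb_or => /and3P[_ /andP[i1 _] /andP[i2 _]].
have [a a1 aP] := step s1 i1; exists a => //.
rewrite !foldr_cat /= aP ffunE eqxx; congr (_ *: foldr _ _ _).
rewrite -iterS; congr iter.
elim: s2 i2 => //= j s2 IH; rewrite inE negb_or eq_sym => /andP[ij /IH ->].
by rewrite ffunE (negPf ij).
Qed.

Lemma cminus_cplus_ket i (r : occ) :
  c false i (c true i (ket c vac r)) = cminus_coef h i (r i) *: ket c vac r.
Proof.
set A := fun u => u - (-1) ^+ par m i *: Nop i u.
have lA : linear A.
  move=> x u u'; rewrite /A lN !scalerDr !scalerN opprD !scalerA.
  by rewrite [x * _]mulrC addrACA.
have Aw : A (ket c vac r) = (1 - (-1) ^+ par m i * (r i)%:R) *: ket c vac r.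
  by rewrite /A (N_ket FV) scalerA scalerBl scale1r.
rewrite (Clq_cmcp (Fock_Clq FV)) /qbracket !(expop_eigen lA _ Aw).
by rewrite -scalerBl !scalerA /cminus_coef mulrA.
Qed.

End FockKets.

(** * The truncated Fock space *)

Section TruncatedFock.
Context (R : realType) (l k m n : nat).
Hypotheses (l_gt0 : (0 < l)%N) (k_gt0 : (0 < k)%N) (l_lt_k : (l < k)%N).
Hypothesis lk_coprime : coprime l k.
Local Notation C := R[i].
Local Notation N := (m + n)%N.
Local Notation h := (qexponent R l k).
Local Notation occ := {ffun 'I_N -> nat}.
Context (V : lmodType C).
Context (c : bool -> 'I_N -> V -> V) (Nop : 'I_N -> V -> V) (vac : V).
Hypothesis FV : is_Fock h c Nop vac.
Local Notation S := (fock_cutoff k c vac).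
Local Notation Fq := (fock_quot k c vac).
Local Notation pi := (@lquot_pi _ V S).
Local Notation cq xi i := (lquot_op (S := S) (c xi i) : Fq -> Fq).
Local Notation Nq i := (lquot_op (S := S) (Nop i) : Fq -> Fq).

Lemma fock_quot_Clq :
  is_Clq_module h (fun xi i => cq xi i) (fun i => Nq i).
Proof.
apply: (lquot_Clq (Fock_Clq FV)); first exact: (fock_ideal_c k_gt0 FV).
exact: (fock_ideal_N FV).
Qed.
Let CV := fock_quot_Clq.

Let cE xi i v : cq xi i (pi v) = pi (c xi i v).
Proof.
exact: (lquot_opE (Clq_c_linear (Fock_Clq FV) xi i) (fock_ideal_c k_gt0 FV xi i)).
Qed.

Let NE i v : Nq i (pi v) = pi (Nop i v).
Proof.
exact: (lquot_opE (Clq_N_linear (Fock_Clq FV) i) (fock_ideal_N FV i)).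
Qed.

Definition valid_occ (r : occ) : bool :=
  [forall i : 'I_N, if (i < m)%N then (r i < k)%N else (r i <= 1)%N].
Local Notation valid := valid_occ.

Definition qket (r : occ) : Fq := pi (ket c vac r).

Let cut_occ (r : occ) : occupation r -> ~~ valid r -> S (ket c vac r).
Proof.
move=> ro /forallPn[j]; case: ifPn => jm rj; last first.
  by have /forallP/(_ j) := ro; rewrite leqNgt jm /= (negPf rj).
by exists r => //; split=> //; exists j; rewrite // leqNgt.
Qed.

Let valid_occupation r : valid r -> occupation r.
Proof.
move=> /forallP rv; apply/forallP => i; apply/implyP => mi.
by have := rv i; rewrite ltnNge mi.
Qed.

(** Membership in the cut-off set only yields some truncated r' with the same ket; linear
    independence forces r' = r. *)
Let cut_valid r : S (ket c vac r) -> occupation r -> ~~ valid r.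
Proof.
move=> [r' [ro' [j jm kr]] E] ro.
suff <- : r' = r by apply/forallPn; exists j; rewrite jm -leqNgt.
have [lam [_ lamE]] := basis_coord (Fock_basis FV).
have := lamE r _ ro'; rewrite E lamE // eqxx; case: eqP => // _ /eqP.
by rewrite oner_eq0.
Qed.

Lemma qket_invalid r : ~~ valid r -> qket r = 0.
Proof.
have [ro|ro] := boolP (occupation r); last first.
  by rewrite /qket (ket_occ FV) // linear0.
move=> nv; rewrite /qket -(linear0 pi); apply/lquot_eq.
by rewrite subr0; apply: mem_lspan; apply: cut_occ.
Qed.

(** Spanning by the surviving kets, put as an induction principle so that linear identities can be
    checked ket by ket. *)
Lemma qket_ind (P : Fq -> Prop) : P 0 ->
  (forall a r x, valid r -> P x -> P (a *: qket r + x)) -> forall x, P x.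
Proof.
move=> P0 PS x; have [v ->] := lquot_pi_surj x.
have /asboolP[s sP ->] := proj2 (Fock_basis FV) v.
elim: s sP => [_|[a u] s IH sP]; first by rewrite big_nil linear0.
have {}IH : P (pi (\sum_(p <- s) p.1 *: p.2)).
  by apply: IH => p ps; apply: sP; rewrite inE ps orbT.
have [r _ /= ru] := sP (a, u) (mem_head _ _).
rewrite big_cons linearP /= -ru -/(qket r).
have [/PS|/qket_invalid ->] := boolP (valid r); first exact.
by rewrite scaler0 add0r.
Qed.

(** For valid r the coordinate functional on [V] kills the span of the truncated kets, hence factors
    through the quotient. *)
Lemma qcoord_exists : exists lam : occ -> Fq -> C,
  (forall r a u v, lam r (a *: u + v) = a * lam r u + lam r v) /\
  (forall r r', valid r' -> lam r (qket r') = (r' == r)%:R).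
Proof.
have [lam [lamP lamE]] := basis_coord (Fock_basis FV).
have lamZ r a u : lam r (a *: u) = a * lam r u.
  have lam0 : lam r 0 = 0.
    by have := lamP r (-1) 0 0; rewrite scaler0 addr0 mulN1r addNr.
  by have := lamP r a u 0; rewrite lam0 !addr0.
have lamI r v : valid r -> v \in lspan S -> lam r v = 0.
  move=> rv /asboolP[s sP ->].
  elim: s sP => [_|[a u] s IH sP].
    by rewrite big_nil -(scale0r 0) lamZ mul0r.
  rewrite big_cons lamP IH ?addr0; last by move=> p ps; apply: sP; rewrite inE ps orbT.
  have Su := sP (a, u) (mem_head _ _); have [r' [ro' _] /= Eu] := Su.
  rewrite -Eu in Su *; rewrite lamE //; case: eqP => [E|_]; last by rewrite mulr0.
  by have := cut_valid Su ro'; rewrite E rv.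
(* Coordinates at invalid labels are set to zero, as those kets vanish in the quotient. *)
pose mu r (x : Fq) := if valid r then lam r (lquot_repr x) else 0.
have muE r v : valid r -> mu r (pi v) = lam r v.
  move=> rv; rewrite /mu rv; apply/eqP; rewrite -subr_eq0; apply/eqP.
  rewrite addrC -mulN1r -lamP scaleN1r addrC; apply: lamI => //.
  by apply/lquot_eq; rewrite lquot_reprK.
exists mu; split=> [r a x y|r r' rv'].
  have [rv|rv] := boolP (valid r); last by rewrite /mu (negPf rv) mulr0 addr0.
  have [u ->] := lquot_pi_surj x; have [v ->] := lquot_pi_surj y.
  by rewrite -linearP !muE // lamP.
have [rv|rv] := boolP (valid r); first by rewrite muE // lamE // valid_occupation.
by rewrite /mu (negPf rv); case: eqP => // E; rewrite -E rv' in rv.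
Qed.

Lemma qcplus i (r : occ) : exists2 a : C, `|a| = 1 &
  cq true i (qket r) = a *: qket (upd r i (r i).+1).
Proof.
have [a a1 aP] := cplus_ket_phase FV i r (norm_cexp_qexponent R l k).
by exists a => //; rewrite cE aP linearZ.
Qed.

Lemma qcminus0 i (r : occ) : r i = 0%N -> cq false i (qket r) = 0.
Proof. by move=> ri; rewrite cE (cminus_ket0 FV) // linear0. Qed.

Lemma qcminus_cplus i (r : occ) :
  cq false i (cq true i (qket r)) = cminus_coef h i (r i) *: qket r.
Proof. by rewrite [cq true i _]cE cE (cminus_cplus_ket FV) linearZ. Qed.

Lemma qnum i (r : occ) : Nq i (qket r) = (r i)%:R *: qket r.
Proof. by rewrite NE (N_ket FV) linearZ. Qed.


Local Notation incr r i := (upd r i (r i).+1).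

Lemma upd_pred (r : occ) (i : 'I_N) :
  (0 < r i)%N -> exists r' : occ, r = incr r' i.
Proof.
move=> ri; exists (upd r i (r i).-1); apply/ffunP => j; rewrite !ffunE eqxx.
by case: eqP => // ->; rewrite prednK.
Qed.

Lemma valid_incr (r : occ) i : valid (incr r i) ->
  valid r /\ (if (i < m)%N then (r i).+1 < k else r i == 0)%N.
Proof.
move=> /forallP rv; split; last first.
  by have := rv i; rewrite ffunE eqxx ltnS leqn0.
apply/forallP => j; have := rv j; rewrite ffunE; case: (eqVneq j i) => [->|//].
by case: ifP => _; exact: ltnW.
Qed.

Lemma cminus_coef_valid_neq0 (r : occ) i : valid (incr r i) ->
  cminus_coef h i (r i) != 0.
Proof.
have cq0 : c_q h != 0 by rewrite gt_eqF // c_q_qexponent_gt0.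
move=> /valid_incr[_]; case: ifPn => im => [rk|/eqP ->].
  by rewrite cminus_coef_boson // mulf_neq0 // qn_qexponent_neq0.
by rewrite cminus_coef_fermion // leqNgt.
Qed.

Lemma cminus_coef_valid_gt0 (r : occ) i : l = 1%N -> valid (incr r i) ->
  0 < cminus_coef h i (r i).
Proof.
have cq0 : 0 < c_q h by rewrite c_q_qexponent_gt0.
move=> l1 /valid_incr[_]; case: ifPn => im => [rk|/eqP ->].
  by rewrite cminus_coef_boson // mulr_gt0 // qn_qexponent_gt0.
by rewrite cminus_coef_fermion // leqNgt.
Qed.

(** The factor of c_i^+ is invertible, so c_i^- c_i^+ = c_q [1 -+ N_i] can be solved for the action
    of c_i^-. *)
Lemma qladder i (r : occ) : exists2 a : C, `|a| = 1 &
  cq true i (qket r) = a *: qket (incr r i) /\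
  cq false i (qket (incr r i)) = (a^-1 * cminus_coef h i (r i)) *: qket r.
Proof.
have [a a1 aP] := qcplus i r; exists a => //; split=> //.
have a0 : a != 0 by rewrite -normr_eq0 a1 oner_eq0.
rewrite -scalerA -qcminus_cplus aP (linZ (Clq_c_linear CV false i)) scalerA.
by rewrite mulVf // scale1r.
Qed.

(** A finite list containing every valid label. Labels with a fermionic entry above 1 may also
    occur, but there both the ket and the coordinate are zero. *)
Let occs : seq occ :=
  [seq [ffun i => g i : nat] | g : {ffun 'I_N -> 'I_k} <- enum {ffun 'I_N -> 'I_k}].

Let occs_uniq : uniq occs.
Proof.
rewrite map_inj_uniq ?enum_uniq // => g g' /ffunP E; apply/ffunP => j.
by apply/val_inj; have := E j; rewrite !ffunE.
Qed.

Let mem_occs r : valid r -> r \in occs.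
Proof.
move=> /forallP rv.
have rk i : (r i < k)%N.
  have := rv i; case: ifP => // _ /leq_ltn_trans; apply.
  (* Fermionic entries fit because 1 <= l < k gives 1 < k. *)
  exact: leq_ltn_trans l_gt0 l_lt_k.
apply/mapP; exists [ffun i => Ordinal (rk i)]; first by rewrite mem_enum.
by apply/ffunP => i; rewrite !ffunE.
Qed.

Section Coordinates.
Context (lam : occ -> Fq -> C).
Hypothesis lamP : forall r a u v, lam r (a *: u + v) = a * lam r u + lam r v.
Hypothesis lamE : forall r r', valid r' -> lam r (qket r') = (r' == r)%:R.

Let lam0 r : lam r 0 = 0.
Proof. by have := lamP r (-1) 0 0; rewrite scaler0 addr0 mulN1r addNr. Qed.

Let lamZ r a u : lam r (a *: u) = a * lam r u.
Proof. by have := lamP r a u 0; rewrite lam0 !addr0. Qed.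

Lemma qexpand x : x = \sum_(r <- occs) lam r x *: qket r.
Proof.
elim/qket_ind: x => [|a r x rv IH].
  by rewrite big1 // => r _; rewrite lam0 scale0r.
under eq_bigr do rewrite lamP lamE // scalerDl.
rewrite big_split /= -IH; congr (_ + _).
rewrite (bigD1_seq r) ?mem_occs //= eqxx mulr1 big1 ?addr0 // => r'.
by rewrite eq_sym => /negPf ->; rewrite mulr0 scale0r.
Qed.

Lemma lam_invalid r x : ~~ valid r -> lam r x = 0.
Proof.
move=> rv; elim/qket_ind: x => // b r0 x r0v x0.
rewrite lamP x0 lamE //; case: eqP => [E|_]; last by rewrite mulr0 addr0.
by rewrite -E r0v in rv.
Qed.

(** In coordinates c_i^- is a weighted shift: among basis kets only the one at r + e_i contributes
    to coordinate r. *)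
Lemma lam_cminus i r : exists2 a : C, (valid (incr r i) -> a != 0) &
  forall w, lam r (cq false i w) = a * lam (incr r i) w.
Proof.
have [a a1 [_ aP]] := qladder i r.
exists (a^-1 * cminus_coef h i (r i)) => [rv|w].
  by rewrite mulf_neq0 ?cminus_coef_valid_neq0 // invr_neq0 // -normr_eq0 a1 oner_eq0.
elim/qket_ind: w => [|b r0 x r0v IH].
  by rewrite -(scale0r 0) (linZ (Clq_c_linear CV false i)) !lamZ !mul0r mulr0.
rewrite (Clq_c_linear CV false i) !lamP IH mulrDr; congr (_ + _).
rewrite lamE //; have [E|ne] := eqVneq r0 (incr r i).
  rewrite E in r0v *; have [rv _] := valid_incr r0v.
  by rewrite aP lamZ lamE // eqxx !mulr1 mulrC.
rewrite !mulr0; have [r0i|/upd_pred[r1 r1E]] := posnP (r0 i).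
  by rewrite qcminus0 // lam0 mulr0.
rewrite r1E in r0v ne *; have [rv _] := valid_incr r0v.
have [a' _ [_ ->]] := qladder i r1.
rewrite lamZ lamE //; case: eqP => [E|_]; last by rewrite !mulr0.
by rewrite E eqxx in ne.
Qed.

End Coordinates.

(** * Irreducibility *)

Let occ0 : occ := [ffun=> 0%N].

Let valid_occ0 : valid occ0.
Proof. by apply/forallP => i; rewrite ffunE k_gt0; case: ifP. Qed.

Let qket_occ0 : qket occ0 = pi vac.
Proof.
congr pi; rewrite /ket; elim: (enum _) => //= i s ->; by rewrite ffunE.
Qed.

Lemma fock_quot_irreducible (H : 'I_N -> Fq -> Fq) :
  is_irreducible (fun xi i => cq xi i) H.
Proof.
have [lam [lamP lamE]] := qcoord_exists.
have lam0 r : lam r 0 = 0.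
  by have := lamP r (-1) 0 0; rewrite scaler0 addr0 mulN1r addNr.
split.
  exists (qket occ0); apply/eqP => E.
  have := lamE occ0 occ0 valid_occ0; rewrite E lam0 eqxx => /eqP.
  by rewrite eq_sym oner_eq0.
move=> W [W0 WP] Wc _.
have WZ a v : v \in W -> a *: v \in W by move=> Wv; rewrite -[_ *: _]addr0 WP.
have [[w Ww w0]|nW] := pselect (exists2 w, w \in W & w != 0); last first.
  left=> v Wv; apply/eqP; apply: contra_notT nW => v0; by exists v.
(* Creation operators rebuild every ket from the vacuum, so it suffices to reach the vacuum. *)
right; suff Wk : qket occ0 \in W.
  elim/qket_ind => [|a r x _ Wx]; first exact: W0.
  apply: WP => //; rewrite /qket /ket.
  elim: (enum _) => /= [|i s IH]; first by rewrite -qket_occ0.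
  elim: (r i) => //= t IHt; rewrite -cE; exact: Wc.
pose deg (r : occ) := (\sum_i r i)%N.
have deg_incr r i : deg (incr r i) = (deg r).+1.
  rewrite /deg (bigD1 i) //= [in RHS](bigD1 i) //= ffunE eqxx -addSn.
  by congr (_ + _)%N; apply: eq_bigr => j /negPf ji; rewrite ffunE ji.
have nz x : x != 0 -> exists2 r, valid r & lam r x != 0.
  move=> x0; have [//|none] := pselect (exists2 r, valid r & lam r x != 0).
  case/eqP: x0; rewrite (qexpand lamP lamE x) big1 // => r _.
  have [rv|/qket_invalid ->] := boolP (valid r); last by rewrite scaler0.
  have [->|xr] := eqVneq (lam r x) 0; first by rewrite scale0r.
  by case: none; exists r.
(* A crude strict bound on the total occupation of kets occurring in w. Applying a c_i^- that does
   not kill w lowers it by one, so induction on d applies. *)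
have [d] : exists d, forall r, valid r -> lam r w != 0 -> (deg r < d)%N.
  exists (N * k.+2)%N.+1 => r rv _; rewrite ltnS -[N in (N * _)%N]card_ord -sum_nat_const.
  apply: leq_sum => i _; have /forallP/(_ i) := rv.
  by case: ifP => _ => [/ltnW/leqW/leqW //|/leq_trans]; apply.
elim: d w Ww w0 => [|d IH] w Ww w0 wd.
  by have [r rv /(wd _ rv)] := nz w w0.
have [[i wi]|none] := pselect (exists i, cq false i w != 0).
  apply: (IH _ (Wc false i _ Ww) wi) => r rv.
  have [a _ ->] := lam_cminus lamP lamE i r.
  rewrite mulf_eq0 negb_or => /andP[_ wr].
  have [iv|iv] := boolP (valid (incr r i)).
    by rewrite -ltnS -(deg_incr r i) wd.
  by rewrite (lam_invalid lamP lamE) ?eqxx in wr.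
(* Now every c_i^- kills w. The coordinate of w at r = r' + e_i is, up to a nonzero factor, the
   coordinate at r' of c_i^- w = 0. *)
have w_occ0 r : valid r -> r != occ0 -> lam r w = 0.
  move=> rv r0; have /existsP[i ri] : [exists i, (0 < r i)%N].
    apply: contraNT r0; rewrite negb_exists => /forallP r0.
    apply/eqP/ffunP => j; rewrite ffunE; apply/eqP.
    by have := r0 j; rewrite lt0n negbK.
  have [r' E] := upd_pred ri; rewrite E in rv *.
  have [a /(_ rv) a0 aP] := lam_cminus lamP lamE i r'.
  apply/eqP; have := aP w; have [->|wi] := eqVneq (cq false i w) 0; last first.
    by case: none; exists i.
  by rewrite lam0 => /esym/eqP; rewrite mulf_eq0 (negPf a0).
have wE : w = lam occ0 w *: qket occ0.
  rewrite [LHS](qexpand lamP lamE) (bigD1_seq occ0) ?mem_occs //= big1 ?addr0 //.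
  move=> r r0; have [rv|/qket_invalid ->] := boolP (valid r); last by rewrite scaler0.
  by rewrite w_occ0 // scale0r.
have l0 : lam occ0 w != 0.
  by apply: contraNneq w0 => E; rewrite wE E scale0r.
by rewrite -[qket _](scalerK l0) -wE WZ.
Qed.


(** * Unitarity for l = 1 *)

Let ket_norm (r : occ) : C := \prod_i \prod_(t < r i) cminus_coef h i t.

Let ket_norm_incr (r : occ) i :
  ket_norm (incr r i) = ket_norm r * cminus_coef h i (r i).
Proof.
rewrite /ket_norm (bigD1 i) //= [in RHS](bigD1 i) //= ffunE eqxx big_ord_recr /=.
rewrite mulrAC; congr (_ * _ * _).
by apply: eq_bigr => j /negPf ji; rewrite ffunE ji.
Qed.

Let ket_norm_gt0 (r : occ) : l = 1%N -> valid r -> 0 < ket_norm r.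
Proof.
move=> l1 rv; apply: prodr_gt0 => i _; apply: prodr_gt0 => t _.
(* The factor at t belongs to the rung from t to t + 1 at index i, and lowering one entry keeps a
   label valid. *)
suff rtv : valid (incr (upd r i t) i).
  by have := cminus_coef_valid_gt0 l1 rtv; rewrite ffunE eqxx.
apply/forallP => j; have /forallP/(_ j) := rv; rewrite !ffunE eqxx.
by case: eqP => [->|//]; case: ifP => _; apply: leq_ltn_trans || apply: leq_trans.
Qed.

Lemma fock_quot_unitary : l = 1%N ->
  exists dot : {dot Fq for Num.conj},
    (forall i u v, dot (cq true i u) v = dot u (cq false i v)) /\
    (forall i u v, dot (Nq i u) v = dot u (Nq i v)).
Proof.
move=> l1; have [lam [lamP lamE]] := qcoord_exists.
have lamI := lam_invalid lamP lamE.
(* Conjugate-linear in the second argument; invalid labels in [occs] contribute nothing because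
   their coordinates vanish. *)
pose f (u v : Fq) : C := \sum_(r <- occs) ket_norm r * lam r u * (lam r v)^*%R.
have normJ r : valid r -> (ket_norm r)^*%R = ket_norm r.
  by move=> rv; apply/CrealP/gtr0_real/ket_norm_gt0.
have fJ u v : f u v = (f v u)^*%R.
  rewrite /f rmorph_sum; apply: eq_bigr => r _ /=; rewrite !rmorphM /= conjCK.
  have [rv|rv] := boolP (valid r); last by rewrite !lamI // conjC0 !mulr0.
  by rewrite normJ // mulrAC.
have fl a u v w : f (a *: u + v) w = a * f u w + f v w.
  rewrite /f mulr_sumr -big_split /=; apply: eq_bigr => r _; rewrite lamP; ring.
have fr a u v w : f w (a *: u + v) = a^*%R * f w u + f w v.
  by rewrite fJ fl rmorphD rmorphM /= -!fJ.
have f0l w : f 0 w = 0.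
  by have := fl (-1) 0 0 w; rewrite scaler0 addr0 mulN1r addNr.
have f0r w : f w 0 = 0 by rewrite fJ f0l conjC0.
have fZl a u w : f (a *: u) w = a * f u w by have := fl a u 0 w; rewrite f0l !addr0.
have fZr a u w : f w (a *: u) = a^*%R * f w u by rewrite fJ fZl rmorphM /= -fJ.
have f_pos u : u != 0 -> 0 < f u u.
  move=> u0; have [r0 r0v ur0] : exists2 r, valid r & lam r u != 0.
    have [//|none] := pselect (exists2 r, valid r & lam r u != 0).
    case/eqP: u0; rewrite (qexpand lamP lamE u) big1 // => r _.
    have [rv|/qket_invalid ->] := boolP (valid r); last by rewrite scaler0.
    have [->|xr] := eqVneq (lam r u) 0; first by rewrite scale0r.
    by case: none; exists r.
  rewrite /f (bigD1_seq r0) ?mem_occs //=; apply: ltr_pwDl.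
    by rewrite -mulrA mulr_gt0 ?ket_norm_gt0 // mul_conjC_gt0.
  apply: sumr_ge0 => r _; rewrite -mulrA.
  have [rv|rv] := boolP (valid r); last by rewrite lamI // mul0r mulr0.
  by rewrite mulr_ge0 ?mul_conjC_ge0 // ltW // ket_norm_gt0.
have fk r r' : valid r -> valid r' ->
    f (qket r) (qket r') = (r == r')%:R * ket_norm r.
  move=> rv rv'; rewrite /f (bigD1_seq r) ?mem_occs //= big1 => [|r1 r1r].
    rewrite addr0 !lamE // eqxx mulr1 eq_sym.
    by case: eqP; rewrite ?conjC1 ?conjC0 ?mulr1 ?mulr0 ?mul1r ?mul0r.
  by rewrite lamE // eq_sym (negPf r1r) mulr0 mul0r.
(* By sesquilinearity this is tested on pairs of kets, where only r' = r + e_i gives a nonzero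
   value. *)
have adj i u v : f (cq true i u) v = f u (cq false i v).
  elim/qket_ind: u => [|a r u rv IH].
    by rewrite -[X in f (_ X)](scale0r 0) (linZ (Clq_c_linear CV true i)) scale0r !f0l.
  rewrite (Clq_c_linear CV true i) !fl IH; congr (_ * _ + _) => {IH}.
  elim/qket_ind: v => [|b r' v rv' IH].
    by rewrite -[X in f _ (_ X)](scale0r 0) (linZ (Clq_c_linear CV false i)) scale0r !f0r.
  rewrite (Clq_c_linear CV false i) !fr IH; congr (_ * _ + _) => {IH}.
  have [c1 c11 [rE rE']] := qladder i r; rewrite rE fZl.
  have c10 : c1 != 0 by rewrite -normr_eq0 c11 oner_eq0.
  have [E|ne] := eqVneq r' (incr r i).
    rewrite E in rv' *; rewrite rE' fZr !fk // !eqxx !mul1r ket_norm_incr.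
    rewrite rmorphM /= fmorphV /=.
    (* A phase is the inverse of its conjugate. *)
    have -> : (c1^*%R)^-1 = c1.
      by rewrite invC_norm conjCK norm_conjC c11 expr1n invr1 mul1r.
    have -> : (cminus_coef h i (r i))^*%R = cminus_coef h i (r i).
      by apply/CrealP/gtr0_real/cminus_coef_valid_gt0.
    by rewrite mulrA mulrAC.
  transitivity (0 : C).
    have [iv|/qket_invalid ->] := boolP (valid (incr r i)); last by rewrite f0l mulr0.
    by rewrite fk // eq_sym (negPf ne) mul0r mulr0.
  have [r0i|/upd_pred[r1 r1E]] := posnP (r' i); first by rewrite qcminus0 // f0r.
  have [c2 _ [_ c2E]] := qladder i r1.
  rewrite r1E in rv' ne *; have [rv1 _] := valid_incr rv'.
  rewrite c2E fZr fk //; case: eqP => [E|_]; last by rewrite mul0r mulr0.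
  by rewrite E eqxx in ne.
(* N_i is diagonal on the orthogonal kets, with real eigenvalues. *)
have adjN i u v : f (Nq i u) v = f u (Nq i v).
  elim/qket_ind: u => [|a r u rv IH].
    by rewrite -[X in f (_ X)](scale0r 0) (linZ (Clq_N_linear CV i)) scale0r !f0l.
  rewrite (Clq_N_linear CV i) !fl IH; congr (_ * _ + _) => {IH}.
  elim/qket_ind: v => [|b r' v rv' IH].
    by rewrite -[X in f _ (_ X)](scale0r 0) (linZ (Clq_N_linear CV i)) scale0r !f0r.
  rewrite (Clq_N_linear CV i) !fr IH; congr (_ * _ + _) => {IH}.
  rewrite !qnum fZl fZr fk // rmorph_nat; case: eqP => [->//|_].
  by rewrite mul0r !mulr0.
have fB : bilinear_for (GRing.Scale.Law.clone _ _ ( *%R ) _)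
    (GRing.Scale.Law.clone _ _ (Num.conj \; *%R) _) f.
  by split=> w a u v /=; rewrite (fl, fr).
(* The flag [false] selects the sign (-1)^0 = 1 in the Hermitian symmetry, absorbed by [mul1r]. *)
pose D : {dot Fq for Num.conj} := HB.pack f
  (bilinear_isBilinear.Build _ _ _ _ _ _ f fB)
  (isHermitianSesquilinear.Build _ Fq false Num.conj f
     (fun u v => etrans (fJ u v) (esym (mul1r _))))
  (isDotProduct.Build _ _ f f_pos).
by exists D.
Qed.

End TruncatedFock.

Theorem mainTheorem7 (R : realType) (m n : nat) (mn_gt0 : (1 <= m + n)%N)
  (l k : nat) (l_gt0 : (0 < l)%N) (k_gt0 : (0 < k)%N) (lk_coprime : coprime l k)
  (l_lt_k : (l < k)%N)
  (F : lmodType R[i]) (c : bool -> 'I_(m + n) -> F -> F)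
  (Nop : 'I_(m + n) -> F -> F) (vac : F)
  (F_Fock : is_Fock (qexponent R l k) c Nop vac) :
  let Fq := fock_quot k c vac in
  let cq := (fun xi i => lquot_op (c xi i)) : bool -> 'I_(m + n) -> Fq -> Fq in
  let Nq := (fun i => lquot_op (Nop i)) : 'I_(m + n) -> Fq -> Fq in
  let Hq := (fun i v => (-1) ^+ par m i *: Nq i v - 2^-1 *: v)
            : 'I_(m + n) -> Fq -> Fq in
  [/\ is_Uq_osp_module (qexponent R l k) cq Hq,
      is_irreducible cq Hq
    & l = 1%N ->
      exists dot : {dot Fq for Num.conj},
        (forall i u v, dot (cq true i u) v = dot u (cq false i v)) /\
        (forall i u v, dot (Nq i u) v = dot u (Nq i v))].
Proof.
move=> Fq cq Nq Hq; split.
- apply: (osp_of_Clq (fock_quot_Clq k_gt0 F_Fock)).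
  exact: qexponent_neqV l_gt0 k_gt0 l_lt_k.
- exact: (fock_quot_irreducible l_gt0 k_gt0 l_lt_k lk_coprime F_Fock).
- exact: (fock_quot_unitary l_gt0 k_gt0 l_lt_k F_Fock).
Qed.
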